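(* Let $\ell,\ell'\ge 2$ be integers and let $Q$, $Q'$ be quantum tori over $\mathbb{C}$ such that the Lie algebras $\mathfrak{sl}_{\ell}(Q)$ and $\mathfrak{sl}_{\ell'}(Q')$ are non-fgc. Let $f\colon \mathfrak{sl}_{\ell'}(Q')\to\mathfrak{sl}_{\ell}(Q)$ be an isomorphism of Lie algebras over $\mathbb{C}$. Then $\ell=\ell'$, and if $\mathfrak h'\subset\mathfrak{sl}_{\ell'}(Q')$ and $\mathfrak h\subset \mathfrak{sl}_\ell(Q)$ denote the standard Cartan subalgebras, then $f(\mathfrak h')$ and $\mathfrak h$ are conjugate under an automorphism of $\mathfrak{sl}_\ell(Q)$, i.e. there is an automorphism $\sigma$ of the Lie algebra $\mathfrak{sl}_\ell(Q)$ with $\sigma(f(\mathfrak h'))=\mathfrak h$.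
   Context: A quantum torus over $\mathbb{C}$ is the unital associative $\mathbb{C}$-algebra $Q$ presented by generators $x_1,\dots,x_n,x_1^{-1},\dots,x_n^{-1}$ and relations $x_ix_i^{-1}=1_Q=x_i^{-1}x_i$, $x_ix_j=q_{ij}x_jx_i$, where the $q_{ij}$ are non-zero complex numbers with $q_{ii}=1$ and $q_{ij}q_{ji}=1$. For a unital associative algebra $A$, $\mathfrak{gl}_\ell(A)$ is the Lie algebra of $\ell\times\ell$ matrices over $A$ with bracket $[x,y]=xy-yx$, and $\mathfrak{sl}_\ell(A)=[\mathfrak{gl}_\ell(A),\mathfrak{gl}_\ell(A)]$ is its derived algebra. The centroid $\mathrm{Ctd}(L)$ of a Lie algebra $L$ over $\mathbb C$ is the algebra of all $\chi\in\mathrm{End}_{\mathbb C}(L)$ with $\chi([a,b])=[\chi(a),b]=[a,\chi(b)]$ for all $a,b\in L$. The Lie algebra $L$ is fgc if it is finitely generated as a module over $\mathrm{Ctd}(L)$, and non-fgc otherwise. For $L=\mathfrak{sl}_\ell(Q)$, being fgc is equivalent to $Q$ being a finitely generated module over its centre; thus non-fgc means that some $q_{ij}$ is not a root of unity. The standard Cartan subalgebra of $\mathfrak{sl}_\ell(Q)$ is $\mathfrak h=\{\sum_{i=1}^\ell s_iE_{ii}: s_i\in\mathbb C,\ \sum_i s_i=0\}$, where $E_{ij}$ are the matrix units; similarly for $\mathfrak h'\subset \mathfrak{sl}_{\ell'}(Q')$. *)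

(* Defs.v *)
From HB Require Import structures.
From mathcomp Require Import all_boot all_order all_algebra.
From mathcomp Require Import boolp classical_sets.

Set Implicit Arguments.
Unset Strict Implicit.
Unset Printing Implicit Defensive.

Import GRing.Theory.
Local Open Scope ring_scope.

HB.mixin Record Lmodule_isLieAlgebra (K : fieldType) L & GRing.Lmodule K L := {
  lie : L -> L -> L;
  lie_linearl : forall (c : K) (x y z : L),
    lie (c *: x + y) z = c *: lie x z + lie y z;
  lie_linearr : forall (c : K) (x y z : L),
    lie z (c *: x + y) = c *: lie z x + lie z y;
  lie_alt : forall x : L, lie x x = 0;
  lie_jacobi : forall x y z : L,
    lie x (lie y z) + lie y (lie z x) + lie z (lie x y) = 0 }.

#[short(type="lieAlgType")]
HB.structure Definition LieAlgebra (K : fieldType) :=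
  { L of Lmodule_isLieAlgebra K L & GRing.Lmodule K L }.

Definition lie_isomorphism (K : fieldType) (L1 L2 : lieAlgType K)
    (f : {linear L1 -> L2}) : Prop :=
  {morph f : x y / lie x y} /\ bijective f.

Definition lie_automorphism (K : fieldType) (L : lieAlgType K)
    (f : {linear L -> L}) : Prop := lie_isomorphism f.

Definition in_centroid (K : fieldType) (L : lieAlgType K)
    (chi : {linear L -> L}) : Prop :=
  forall a b : L, chi (lie a b) = lie (chi a) b /\ chi (lie a b) = lie a (chi b).

(* The centroid acts on L by evaluation. *)
Definition fgc (K : fieldType) (L : lieAlgType K) : Prop :=
  exists (m : nat) (v : 'I_m -> L), forall x : L,
  exists chi : 'I_m -> {linear L -> L},
    (forall i, in_centroid (chi i)) /\ x = \sum_(i < m) chi i (v i).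

Section Derived.
Variables (K : fieldType) (L : lieAlgType K).

Definition in_derived : {pred L} := fun x : L =>
  `[< exists (m : nat) (c : 'I_m -> K) (a b : 'I_m -> L),
        x = \sum_(i < m) c i *: lie (a i) (b i) >].

Lemma lie_in_derived (a b : L) : lie a b \in in_derived.
Proof.
apply/asboolP; exists 1%N, (fun=> 1), (fun=> a), (fun=> b).
by rewrite big_ord1 scale1r.
Qed.

Fact in_derived_submod_closed : submod_closed in_derived.
Proof.
split=> [|k u v /asboolP[m [c [a [b ->]]]] /asboolP[m' [c' [a' [b' ->]]]]].
  by apply/asboolP; exists 0%N, (fun=> 0), (fun=> 0), (fun=> 0); rewrite big_ord0.
pose g T (r : 'I_m -> T) (r' : 'I_m' -> T) i :=
  match split i with inl j => r j | inr j => r' j end.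
apply/asboolP; exists (m + m')%N, (g _ (fun i => k * c i) c'), (g _ a a'), (g _ b b').
rewrite big_split_ord /= scaler_sumr; congr (_ + _); apply: eq_bigr => i _.
  by rewrite /g -[lshift m' i]/(unsplit (inl i)) unsplitK scalerA.
by rewrite /g -[rshift m i]/(unsplit (inr i)) unsplitK.
Qed.

HB.instance Definition _ :=
  GRing.isSubmodClosed.Build K L in_derived in_derived_submod_closed.

Record derived_algebra : predArgType :=
  DerivedAlgebra { derived_val :> L; derived_valP : derived_val \in in_derived }.

HB.instance Definition _ := [isSub for derived_val].
HB.instance Definition _ := [Choice of derived_algebra by <:].
HB.instance Definition _ := [SubChoice_isSubLmodule of derived_algebra by <:].

Definition derived_lie (x y : derived_algebra) : derived_algebra :=
  DerivedAlgebra (lie_in_derived (val x) (val y)).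

Fact derived_linearl (c : K) (x y z : derived_algebra) :
  derived_lie (c *: x + y) z = c *: derived_lie x z + derived_lie y z.
Proof. by apply: val_inj; exact: lie_linearl. Qed.

Fact derived_linearr (c : K) (x y z : derived_algebra) :
  derived_lie z (c *: x + y) = c *: derived_lie z x + derived_lie z y.
Proof. by apply: val_inj; exact: lie_linearr. Qed.

Fact derived_alt (x : derived_algebra) : derived_lie x x = 0.
Proof. by apply: val_inj; exact: lie_alt. Qed.

Fact derived_jacobi (x y z : derived_algebra) :
  derived_lie x (derived_lie y z) + derived_lie y (derived_lie z x)
    + derived_lie z (derived_lie x y) = 0.
Proof. by apply: val_inj; exact: lie_jacobi. Qed.

HB.instance Definition _ := Lmodule_isLieAlgebra.Build K derived_algebra
  derived_linearl derived_linearr derived_alt derived_jacobi.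

End Derived.

(* An alias of 'M[A]_l, which carries a K-module structure (rather than the
   A-module structure of 'M[A]_l) and the commutator bracket. *)
Definition gl (K : fieldType) (A : algType K) (l : nat) : Type := 'M[A]_l.

Section GeneralLinear.
Variables (K : fieldType) (A : algType K) (l : nat).
Local Notation gl := (gl A l).

HB.instance Definition _ := GRing.Zmodule.copy gl 'M[A]_l.

Definition gl_scale (c : K) (x : gl) : gl := map_mx (fun a : A => c *: a) x.

Fact gl_scaleA (c d : K) (x : gl) : gl_scale c (gl_scale d x) = gl_scale (c * d) x.
Proof. by apply/matrixP=> i j; rewrite !mxE scalerA. Qed.
Fact gl_scale1 : left_id 1 gl_scale.
Proof. by move=> x; apply/matrixP=> i j; rewrite !mxE scale1r. Qed.
Fact gl_scaleDr : right_distributive gl_scale +%R.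
Proof. by move=> c x y; apply/matrixP=> i j; rewrite !mxE scalerDr. Qed.
Fact gl_scaleDl (x : gl) : {morph gl_scale^~ x : c d / c + d}.
Proof. by move=> c d; apply/matrixP=> i j; rewrite !mxE scalerDl. Qed.

HB.instance Definition _ := GRing.Zmodule_isLmodule.Build K gl
  gl_scaleA gl_scale1 gl_scaleDr gl_scaleDl.

Definition gl_lie (x y : gl) : gl := (x : 'M[A]_l) *m y - (y : 'M[A]_l) *m x.

Fact gl_mulmxl (c : K) (x y z : gl) :
  ((c *: x + y : gl) : 'M[A]_l) *m z
  = (c *: ((x : 'M[A]_l) *m z : gl) + ((y : 'M[A]_l) *m z : gl) : gl).
Proof.
rewrite [LHS]mulmxDl; congr (_ + _ : 'M[A]_l); apply/matrixP=> i j.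
by rewrite !mxE scaler_sumr; apply: eq_bigr => k _; rewrite mxE scalerAl.
Qed.

Fact gl_mulmxr (c : K) (x y z : gl) :
  (z : 'M[A]_l) *m (c *: x + y : gl)
  = (c *: ((z : 'M[A]_l) *m x : gl) + ((z : 'M[A]_l) *m y : gl) : gl).
Proof.
rewrite [LHS]mulmxDr; congr (_ + _ : 'M[A]_l); apply/matrixP=> i j.
by rewrite !mxE scaler_sumr; apply: eq_bigr => k _; rewrite mxE scalerAr.
Qed.

Fact gl_linearl (c : K) (x y z : gl) :
  gl_lie (c *: x + y) z = c *: gl_lie x z + gl_lie y z.
Proof. by rewrite /gl_lie gl_mulmxl gl_mulmxr scalerBr opprD addrACA. Qed.

Fact gl_linearr (c : K) (x y z : gl) :
  gl_lie z (c *: x + y) = c *: gl_lie z x + gl_lie z y.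
Proof. by rewrite /gl_lie gl_mulmxl gl_mulmxr scalerBr opprD addrACA. Qed.

Fact gl_alt (x : gl) : gl_lie x x = 0.
Proof. exact: subrr. Qed.

Fact gl_jacobi (x y z : gl) :
  gl_lie x (gl_lie y z) + gl_lie y (gl_lie z x) + gl_lie z (gl_lie x y) = 0.
Proof.
pose mx (u : gl) : 'M[A]_l := u.
rewrite -[LHS]/(mx x *m (mx y *m mx z - mx z *m mx y)
    - (mx y *m mx z - mx z *m mx y) *m mx x
  + (mx y *m (mx z *m mx x - mx x *m mx z)
    - (mx z *m mx x - mx x *m mx z) *m mx y)
  + (mx z *m (mx x *m mx y - mx y *m mx x)
    - (mx x *m mx y - mx y *m mx x) *m mx z)).
rewrite !mulmxBr !mulmxBl !mulmxA !opprB !addrA.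
rewrite [LHS](ACl ((1*12)*(7*2)*(3*10)*(5*4)*(9*8)*(11*6))).
by rewrite /= !subrr !addr0.
Qed.

HB.instance Definition _ := Lmodule_isLieAlgebra.Build K gl
  gl_linearl gl_linearr gl_alt gl_jacobi.

End GeneralLinear.

Definition sl (K : fieldType) (A : algType K) (l : nat) : lieAlgType K :=
  derived_algebra (gl A l).

Definition standard_cartan (K : fieldType) (A : algType K) (l : nat) :
    set (sl A l) :=
  [set z | exists s : 'I_l -> K, \sum_(i < l) s i = 0 /\
     val z = \sum_(i < l) s i *: (delta_mx i i : gl A l)]%classic.
Arguments standard_cartan {K} A l _.

Definition quantum_matrix (K : fieldType) (n : nat) (q : 'M[K]_n) : Prop :=
  [/\ forall i j, q i j != 0, forall i, q i i = 1
    & forall i j, q i j * q j i = 1].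

(* x i and y i stand for the generators x_i and x_i^-1. *)
Definition torus_relations (K : fieldType) (n : nat) (q : 'M[K]_n)
    (A : algType K) (x y : 'I_n -> A) : Prop :=
  [/\ forall i, x i * y i = 1, forall i, y i * x i = 1
    & forall i j, x i * x j = q i j *: (x j * x i)].

(* Q is presented, as a unital associative K-algebra, by the generators x_i,
   x_i^-1 and the relations above: Q satisfies them and is universal for them.
   This determines Q up to a unique isomorphism preserving the generators. *)
Definition torus_presentation (K : fieldType) (n : nat) (q : 'M[K]_n)
    (Q : algType K) (x y : 'I_n -> Q) : Prop :=
  torus_relations q x y /\
  forall (A : algType K) (u v : 'I_n -> A), torus_relations q u v ->
  exists phi : {lrmorphism Q -> A},
    (forall i, phi (x i) = u i /\ phi (y i) = v i) /\
    (forall psi : {lrmorphism Q -> A},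
       (forall i, psi (x i) = u i /\ psi (y i) = v i) -> psi =1 phi).

Definition quantum_torus (K : fieldType) (Q : algType K) : Prop :=
  exists (n : nat) (q : 'M[K]_n) (x y : 'I_n -> Q),
    quantum_matrix q /\ torus_presentation q x y.

(* Main.v *)
Require Import Defs.
From HB Require Import structures.
From mathcomp Require Import all_boot all_order all_algebra.
From mathcomp Require Import ring boolp classical_sets reals complex.

Set Implicit Arguments.
Unset Strict Implicit.
Unset Printing Implicit Defensive.

Import Order.TTheory GRing.Theory Num.Theory.
Local Open Scope ring_scope.

(* The key point is that only an isomorphism of coordinate algebras has to be
   found: if [theta : Q' -> Q] is an isomorphism (or an anti-isomorphism) and
   [l = l'], then entrywise application of [theta] (followed by minus the
   transpose in the second case) is an isomorphism [Theta] of [sl_l(Q')] onto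
   [sl_l(Q)] that matches the standard Cartan subalgebras, and
   [sigma = Theta f^-1] does the job.  A quantum torus is determined by the
   bicharacter [beta] on Z^n with [x^a x^b = beta(a, b) x^b x^a], so one must
   recover [l], n and [beta], up to inversion, from the Lie algebra.

   Let [e], [E_b], [Y_b] be the images under [f] of the principal nilpotent
   matrix and of the matrices with [b] in the upper right, resp. lower left
   corner only.  Weights of the principal grading give [e^l' = 0], and
   [(ad e)^(2l'-2) Y_b] gives [E_b = N Y_b N] with [N = e^(l'-1)].  As a quantum
   torus has polynomial growth, any l+1 columns in Q^l are right dependent;
   hence [l' <= l] and, by symmetry, [l = l'].  Then [N] has rank one, so the
   operators [E_b Y_1] act on a line over the skew field of fractions of [Q],
   where they form a Jordan homomorphic image of [Q'].  Comparing leading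
   monomials yields an additive map [phi : Z^n' -> Z^n] with
   [beta(phi a, phi b) = beta'(a, b)^(+-1)].  The sign is uniform because a group
   is not the union of two proper subgroups, and since the centroid is
   transported by [f], [phi] maps the radical of [beta'] bijectively onto that of
   [beta].  Composing with the map obtained from [f^-1] gives an endomorphism of
   a lattice preserving a bicharacter, and Cayley-Hamilton shows that it is onto;
   so [phi] is bijective. *)

(** * Monomial bases and coefficients *)

(* A translation invariant order, given by its cone [pos] of positive elements. *)
Definition translation_order (G : zmodType) (pos : pred G) : Prop :=
  [/\ forall a b, pos a -> pos b -> pos (a + b),
      forall a, a != 0 -> pos a || pos (- a) & ~~ pos 0].

(** Leading terms for the reversed order are lowest terms; [unit_monomial] compares both ends of an
    element. *)
Lemma translation_order_opp (G : zmodType) (pos : pred G) :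
  translation_order pos -> translation_order (fun a => pos (- a)).
Proof.
case=> posD posT pos0; split=> [a b pa pb|a a0|].
- by rewrite opprD; exact: posD.
- by rewrite opprK orbC; exact: posT.
- by rewrite oppr0.
Qed.

Definition lex_pos (n : nat) (a : 'rV[int]_n) : bool :=
  [exists i, (0 < a 0 i) && [forall j : 'I_n, (j < i)%N ==> (a 0 j == 0)]].

Lemma lex_posP (n : nat) (a : 'rV[int]_n) :
  reflect (exists2 i, 0 < a 0 i & forall j : 'I_n, (j < i)%N -> a 0 j = 0)
    (lex_pos a).
Proof.
apply: (iffP existsP) => [[i /andP[ai /forallP aj]]|[i ai aj]]; exists i => //.
  by move=> j ji; apply/eqP; move: (aj j); rewrite ji.
by rewrite ai; apply/forallP=> j; apply/implyP=> /aj ->.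
Qed.

Lemma lex_translation_order (n : nat) : translation_order (@lex_pos n).
Proof.
split=> [a b /lex_posP[i ai ja] /lex_posP[k bk jb]|a a0|].
- apply/lex_posP; case: (ltngtP i k) => [ik|ki|/val_inj ik].
  + exists i; first by rewrite mxE (jb _ ik) addr0.
    by move=> j ji; rewrite mxE (ja _ ji) (jb _ (ltn_trans ji ik)) addr0.
  + exists k; first by rewrite mxE (ja _ ki) add0r.
    by move=> j jk; rewrite mxE (ja _ (ltn_trans jk ki)) (jb _ jk) addr0.
  + subst k; exists i; first by rewrite mxE addr_gt0.
    by move=> j ji; rewrite mxE (ja _ ji) (jb _ ji) addr0.
- have [i ai] : exists i, a 0 i != 0.
    apply/existsP; apply: contraNT a0 => /existsPn a0; apply/eqP/rowP=> i.
    by rewrite mxE; apply/eqP; have := a0 i; rewrite negbK.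
  case: (@arg_minnP _ i (fun i => a 0 i != 0) val ai) => k ak kmin.
  have jk (j : 'I_n) : (j < k)%N -> a 0 j = 0.
    by move=> jk; apply/eqP; apply: contraLR jk; rewrite -leqNgt; exact: kmin.
  case: (ltrgtP 0 (a 0 k)) => [ak0|ak0|ak0].
  + by apply/orP; left; apply/lex_posP; exists k.
  + apply/orP; right; apply/lex_posP; exists k; first by rewrite mxE oppr_gt0.
    by move=> j /jk; rewrite mxE => ->; rewrite oppr0.
  + by rewrite -ak0 eqxx in ak.
- by apply/lex_posP=> -[k]; rewrite mxE ltxx.
Qed.

(** A twisted group algebra of [G]. The scalar in [tbM] is left existential, so the order of the
    generators inside a monomial never has to be tracked, and the same interface fits the opposite
    algebra. *)
Record torus_basis (K : fieldType) (Q : algType K) (G : zmodType) (X : G -> Q) :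
    Prop := TorusBasis {
  tb0 : X 0 = 1;
  tbM : forall a b, exists2 c : K, c != 0 & X a * X b = c *: X (a + b);
  tb_free : forall (s : seq G) (c : G -> K), uniq s ->
    \sum_(a <- s) c a *: X a = 0 -> forall a, a \in s -> c a = 0;
  tb_span : forall y, exists (s : seq G) (c : G -> K),
    y = \sum_(a <- s) c a *: X a }.

Lemma sum_subset (T : eqType) (V : zmodType) (s t : seq T) (F : T -> V) :
  uniq s -> uniq t -> {subset s <= t} -> (forall b, b \notin s -> F b = 0) ->
  \sum_(b <- s) F b = \sum_(b <- t) F b.
Proof.
move=> us ut st F0; rewrite [RHS](bigID (mem s)) /= [X in _ + X]big1 ?addr0 //.
rewrite -[RHS]big_filter; apply: perm_big; apply: uniq_perm => //.
  by rewrite filter_uniq.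
by move=> b; rewrite mem_filter; case: (boolP (b \in s)) => //= /st ->.
Qed.

Section Coefficients.
Variables (K : fieldType) (Q : algType K) (G : zmodType) (X : G -> Q).
Hypothesis XB : torus_basis X.

Lemma tb_expand (y : Q) : exists sc : seq G * (G -> K),
  [/\ uniq sc.1, forall a, (a \in sc.1) = (sc.2 a != 0)
    & y = \sum_(a <- sc.1) sc.2 a *: X a].
Proof.
have [s [c ->]] := tb_span XB y.
(* Exponents may repeat in [s]; every repetition contributes the same scalar [c a], so merging them
   multiplies it by the multiplicity. *)
pose c' a := c a *+ count_mem a s.
have -> : \sum_(a <- s) c a *: X a = \sum_(a <- undup s) c' a *: X a.
  rewrite -big_undup_iterop_count; apply: eq_bigr => a _.
  by rewrite /c' -scalerMnl.
exists ([seq a <- undup s | c' a != 0], c'); split=> [|a|] /=.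
- by rewrite filter_uniq ?undup_uniq.
- rewrite mem_filter mem_undup; case: (boolP (c' a == 0)) => //= c'a.
  by apply: contraNT c'a => /count_memPn; rewrite /c' => ->.
- rewrite big_filter [LHS](bigID (fun a => c' a != 0)) /= [X in _ + X]big1 ?addr0 //.
  by move=> a; rewrite negbK => /eqP ->; rewrite scale0r.
Qed.

Definition supp (y : Q) : seq G := (projT1 (cid (tb_expand y))).1.
Definition tcoef (y : Q) : G -> K := (projT1 (cid (tb_expand y))).2.

Lemma supp_uniq y : uniq (supp y).
Proof. by rewrite /supp; case: cid => sc []. Qed.

Lemma mem_supp y a : (a \in supp y) = (tcoef y a != 0).
Proof. by rewrite /supp /tcoef; case: cid => sc []. Qed.

Lemma tcoefE y : y = \sum_(a <- supp y) tcoef y a *: X a.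
Proof. by rewrite /supp /tcoef; case: cid => sc []. Qed.

(** The expansion behind [tcoef] is picked by choice. Writing the chosen and the given expansion
    over a common list of exponents, freeness applied to the difference shows that they agree. *)
Lemma tcoef_sum (s : seq G) (c : G -> K) : uniq s ->
  forall a, tcoef (\sum_(b <- s) c b *: X b) a = if a \in s then c a else 0.
Proof.
move=> us a; set y := \sum_(b <- s) _.
pose t := undup (s ++ supp y).
pose d b := (if b \in s then c b else 0) - tcoef y b.
have d0 : \sum_(b <- t) d b *: X b = 0.
  under eq_bigr do rewrite scalerBl.
  rewrite sumrB -(sum_subset (s := s) (t := t)) ?undup_uniq // => [|b bs|b /negbTE ->]; last first.
  - by rewrite scale0r.
  - by rewrite mem_undup mem_cat bs.
  rewrite -(sum_subset (t := t) (supp_uniq y)) ?undup_uniq // => [|b bs|b]; last first.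
  - by rewrite mem_supp negbK => /eqP ->; rewrite scale0r.
  - by rewrite mem_undup mem_cat bs orbT.
  rewrite -tcoefE /y; apply/eqP; rewrite subr_eq0; apply/eqP.
  by rewrite !big_seq; apply: eq_bigr => b ->.
have := tb_free XB (undup_uniq _) d0 (a := a); rewrite mem_undup mem_cat mem_supp.
case: (boolP (a \in s)) => [as_ /(_ isT) /subr0_eq|as_ /=].
  by rewrite as_.
case: eqP => //= _ /(_ isT) /eqP; rewrite /d (negbTE as_) sub0r oppr_eq0.
by move/eqP.
Qed.

Lemma tcoefP y (s : seq G) (c : G -> K) :
  y = \sum_(a <- s) c a *: X a -> uniq s -> (forall a, a \notin s -> c a = 0) ->
  tcoef y =1 c.
Proof.
move=> -> us cs a; rewrite tcoef_sum //; case: ifP => // /negbT; by move/cs.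
Qed.

Lemma tcoef_inj y z : tcoef y =1 tcoef z -> y = z.
Proof.
move=> yz; rewrite (tcoefE y) (tcoefE z).
have p : perm_eq (supp y) (supp z).
  by apply: uniq_perm; rewrite ?supp_uniq // => a; rewrite !mem_supp yz.
by rewrite (perm_big _ p); apply: eq_bigr => a _; rewrite yz.
Qed.

Lemma tcoef_linear_proof k y z a : tcoef (k *: y + z) a = k * tcoef y a + tcoef z a.
Proof.
pose t := undup (supp y ++ supp z).
have tE w : {subset supp w <= t} -> w = \sum_(b <- t) tcoef w b *: X b.
  move=> wt; rewrite {1}[w]tcoefE.
  apply: sum_subset; rewrite ?supp_uniq ?undup_uniq // => b.
  by rewrite mem_supp negbK => /eqP ->; rewrite scale0r.
apply: (@tcoefP _ t (fun a => k * tcoef y a + tcoef z a)); [|exact: undup_uniq|move=> b].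
  have yt : {subset supp y <= t} by move=> b bs; rewrite mem_undup mem_cat bs.
  have zt : {subset supp z <= t} by move=> b bs; rewrite mem_undup mem_cat bs orbT.
  rewrite {1}(tE y yt) {1}(tE z zt) scaler_sumr -big_split; apply: eq_bigr => b _ /=.
  by rewrite scalerDl scalerA.
rewrite mem_undup mem_cat !mem_supp negb_or !negbK => /andP[/eqP -> /eqP ->].
by rewrite mulr0 addr0.
Qed.

Lemma tcoef0 a : tcoef 0 a = 0.
Proof. by apply: (tcoefP (s := [::]) (c := fun=> 0)) => //; rewrite big_nil. Qed.

Lemma tcoefD y z a : tcoef (y + z) a = tcoef y a + tcoef z a.
Proof. by rewrite -[y]scale1r tcoef_linear_proof mul1r scale1r. Qed.

Lemma tcoefZ k y a : tcoef (k *: y) a = k * tcoef y a.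
Proof. by rewrite -[k *: y]addr0 tcoef_linear_proof tcoef0 addr0. Qed.

Lemma tcoefN y a : tcoef (- y) a = - tcoef y a.
Proof. by rewrite -scaleN1r tcoefZ mulN1r. Qed.

Lemma tcoefX b a : tcoef (X b) a = (a == b)%:R.
Proof.
have := tcoef_sum (s := [:: b]) (fun=> 1) isT a.
by rewrite big_seq1 scale1r inE => ->; case: eqP.
Qed.

Lemma tcoef_sumr (I : Type) (r : seq I) (P : pred I) (E : I -> Q) a :
  tcoef (\sum_(i <- r | P i) E i) a = \sum_(i <- r | P i) tcoef (E i) a.
Proof. exact: (big_morph (fun y => tcoef y a) (fun y z => tcoefD y z a) (tcoef0 a)). Qed.

Lemma tb_neq0 a : X a != 0.
Proof.
apply/negP=> /eqP X0; have := tcoefX a a; rewrite X0 tcoef0 eqxx => /esym/eqP.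
by rewrite oner_eq0.
Qed.

End Coefficients.

(** * Monomials in the generators *)

Section Proportional.
Variables (K : fieldType) (A : algType K).

(** Working up to non-zero scalars avoids computing the products of the [q i j] that arise when
    monomials are multiplied. *)
Definition proportional (z w : A) : Prop := exists2 c : K, c != 0 & z = c *: w.
Local Notation "z ~ w" := (proportional z w) (at level 70).

Lemma propor_refl z : z ~ z.
Proof. by exists 1; rewrite ?oner_eq0 ?scale1r. Qed.

Lemma propor_sym z w : z ~ w -> w ~ z.
Proof.
by case=> c c0 ->; exists c^-1; rewrite ?invr_eq0 ?scalerA ?mulVf ?scale1r.
Qed.

Lemma propor_trans y z w : z ~ y -> y ~ w -> z ~ w.
Proof.
case=> c c0 -> [d d0 ->]; exists (c * d); rewrite ?scalerA //.
by rewrite mulf_neq0.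
Qed.

Lemma proporM z z' w w' : z ~ w -> z' ~ w' -> z * z' ~ w * w'.
Proof.
case=> c c0 -> [d d0 ->]; exists (c * d); first by rewrite mulf_neq0.
by rewrite -scalerAl -scalerAr scalerA.
Qed.

Definition skew_comm (z w : A) : Prop := z * w ~ w * z.

Lemma skew_comm_sym z w : skew_comm z w -> skew_comm w z.
Proof. exact: propor_sym. Qed.

Lemma skew_comm1 z : skew_comm z 1.
Proof. by rewrite /skew_comm mulr1 mul1r; exact: propor_refl. Qed.

Lemma skew_commM z w w' : skew_comm z w -> skew_comm z w' -> skew_comm z (w * w').
Proof.
move=> zw zw'; rewrite /skew_comm mulrA; apply: propor_trans.
  exact: proporM zw (propor_refl w').
by rewrite -mulrA -[w * w' * z]mulrA; apply: proporM (propor_refl w) zw'.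
Qed.

Lemma skew_commX z w m : skew_comm z w -> skew_comm z (w ^+ m).
Proof.
move=> zw; elim: m => [|m IHm]; first exact: skew_comm1.
by rewrite exprS; exact: skew_commM.
Qed.

Lemma skew_commV z w w' : w * w' = 1 -> w' * w = 1 -> skew_comm z w ->
  skew_comm z w'.
Proof.
move=> ww' w'w zw; apply: propor_sym; rewrite -[w' * z]mulr1 -{1}ww'.
have -> : z * w' = w' * (w * z) * w' by rewrite !mulrA w'w mul1r.
rewrite mulrA; apply: proporM (propor_refl _); rewrite -mulrA.
exact: proporM (propor_refl _) zw.
Qed.

Lemma prod_skew_comm (I : Type) (r : seq I) (f g : I -> A) :
  (forall i j, skew_comm (f i) (g j)) ->
  (\prod_(i <- r) f i) * (\prod_(i <- r) g i) ~ \prod_(i <- r) (f i * g i).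
Proof.
move=> fg; elim: r => [|i r IHr].
  by rewrite !big_nil mulr1; exact: propor_refl.
rewrite !big_cons; apply: propor_trans (proporM (propor_refl (f i * g i)) IHr).
rewrite -!mulrA; apply: proporM (propor_refl _) _; rewrite !mulrA.
apply: proporM (propor_refl _); apply: skew_comm_sym.
elim: r {IHr} => [|j r IHr]; rewrite ?big_nil ?big_cons; first exact: skew_comm1.
by apply: skew_commM IHr; apply: skew_comm_sym.
Qed.

End Proportional.

Section Monomials.
Variables (K : fieldType) (n : nat) (A : algType K) (x y : 'I_n -> A).
Local Notation "z ~ w" := (proportional z w) (at level 70).

Definition torus_pow (i : 'I_n) (k : int) : A :=
  match k with Posz m => x i ^+ m | Negz m => y i ^+ m.+1 end.

Definition torus_mono (a : 'rV[int]_n) : A := \prod_(i < n) torus_pow i (a 0 i).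

Lemma torus_mono0 : torus_mono 0 = 1.
Proof. by rewrite /torus_mono big1 // => i _; rewrite mxE. Qed.

Lemma prod_delta (R : pzSemiRingType) (i : 'I_n) (z : 'I_n -> R) :
  (forall j, j != i -> z j = 1) -> \prod_j z j = z i.
Proof.
move=> z1; rewrite (eq_bigr (fun j => if j == i then z j else 1)).
  by rewrite -big_mkcond big_pred1_eq.
by move=> j _; case: eqP => // /eqP/z1.
Qed.

Lemma torus_mono_delta i (k : int) :
  torus_mono (\row_j (if j == i then k else 0)) = torus_pow i k.
Proof.
rewrite /torus_mono (@prod_delta _ i) => [|j /negbTE ji]; first by rewrite mxE eqxx.
by rewrite mxE ji.
Qed.

Variable (q : 'M[K]_n).
Hypothesis rel_xy : torus_relations q x y.
Hypothesis q_neq0 : forall i j, q i j != 0.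

(** Writing integers as differences of naturals gives additivity of [torus_pow] without a case
    analysis on signs. *)
Lemma torus_powB i (m p : nat) : torus_pow i (m%:Z - p%:Z) = x i ^+ m * y i ^+ p.
Proof.
have [xy yx _] := rel_xy.
elim: m p => [|m IHm] [|p].
- by rewrite mul1r.
- by rewrite mul1r sub0r -NegzE.
- by rewrite subr0 mulr1.
- rewrite -addn1 -[p.+1]addn1 !PoszD opprD addrACA subrr addr0 IHm.
  by rewrite !addn1 exprSr exprS mulrA -[x i ^+ m * x i * y i]mulrA xy mulr1.
Qed.

Lemma torus_powD i (k l : int) : torus_pow i (k + l) = torus_pow i k * torus_pow i l.
Proof.
have [xy yx _] := rel_xy.
have sub_nat (j : int) : exists m p : nat, j = m%:Z - p%:Z.
  by case: j => j; [exists j, 0%N; rewrite subr0|exists 0%N, j.+1; rewrite NegzE sub0r].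
have [m [p ->]] := sub_nat k; have [m' [p' ->]] := sub_nat l.
rewrite addrACA -opprD -!PoszD !torus_powB !exprD -!mulrA; congr (_ * _).
rewrite !mulrA; congr (_ * _).
apply/commrX/commr_sym/commrX.
by rewrite /GRing.comm xy yx.
Qed.

Lemma torus_pow_skew_comm i j k l : skew_comm (torus_pow i k) (torus_pow j l).
Proof.
have [xy yx qxy] := rel_xy.
have xx : skew_comm (x i) (x j) by exists (q i j).
have xV : skew_comm (x i) (y j) by apply: skew_commV xx.
have Vx : skew_comm (x j) (y i) by apply: skew_commV (skew_comm_sym xx).
have VV : skew_comm (y i) (y j) by apply: skew_commV (skew_comm_sym Vx).
case: k l => k [] l; apply: skew_commX; apply: skew_comm_sym; apply: skew_commX;
  by first [assumption | apply: skew_comm_sym; assumption].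
Qed.

Lemma torus_monoM a b : torus_mono a * torus_mono b ~ torus_mono (a + b).
Proof.
rewrite /torus_mono; under [X in _ ~ X]eq_bigr do rewrite mxE torus_powD.
by apply: prod_skew_comm => i j; exact: torus_pow_skew_comm.
Qed.

End Monomials.

Section GeneratedSubalgebra.
Variables (K : fieldType) (Q : algType K) (I : Type) (x y : I -> Q).

(** The impredicative form makes the induction principle [generatedP] immediate. The subalgebra is
    turned into a type so that the universal property of [Q] can be applied with it as the
    target. *)
Definition generated : {pred Q} := fun z =>
  `[< forall P : Q -> Prop, P 1 -> (forall c u v, P u -> P v -> P (c *: u + v)) ->
      (forall u v, P u -> P v -> P (u * v)) -> (forall i, P (x i) /\ P (y i)) -> P z >].

Fact generated_subalg_closed : subalg_closed generated.
Proof.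
split=> [|c u v /asboolP Gu /asboolP Gv|u v /asboolP Gu /asboolP Gv];
  apply/asboolP=> P P1 Plin PM Pg //.
  exact: Plin (Gu P P1 Plin PM Pg) (Gv P P1 Plin PM Pg).
exact: PM (Gu P P1 Plin PM Pg) (Gv P P1 Plin PM Pg).
Qed.

HB.instance Definition _ := GRing.isSubalgClosed.Build K Q generated
  (GRing.subalg_closed_semi generated_subalg_closed).

Record generated_type : predArgType :=
  Generated { generated_val :> Q; generated_valP : generated_val \in generated }.

HB.instance Definition _ := [isSub for generated_val].
HB.instance Definition _ := [Choice of generated_type by <:].
HB.instance Definition _ := [SubChoice_isSubAlgebra of generated_type by <:].

Lemma generatedP (P : Q -> Prop) : P 1 ->
  (forall c u v, P u -> P v -> P (c *: u + v)) ->
  (forall u v, P u -> P v -> P (u * v)) -> (forall i, P (x i) /\ P (y i)) ->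
  forall z : generated_type, P (val z).
Proof. by move=> P1 Plin PM Pg [z /= /asboolP]; apply. Qed.

Lemma generated_genl i : x i \in generated.
Proof. by apply/asboolP=> P _ _ _ /(_ i)[]. Qed.

Lemma generated_genr i : y i \in generated.
Proof. by apply/asboolP=> P _ _ _ /(_ i)[]. Qed.

Definition generated_incl (z : generated_type) : Q := generated_val z.

HB.instance Definition _ := GRing.isLinear.Build K generated_type Q *:%R
  generated_incl (fun _ _ _ => erefl).
HB.instance Definition _ := GRing.isMonoidMorphism.Build generated_type Q
  generated_incl (conj erefl (fun _ _ => erefl)).

End GeneratedSubalgebra.

(** * A presented quantum torus has a monomial basis *)

(** In characteristic zero [2 ^ m - 1] is non-zero for every natural [m > 0]. Hence scaling one
    generator by 2 tells apart monomials whose exponents of that generator differ. *)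
Lemma pow2z_inj (K : fieldType) : [pchar K] =i pred0 ->
  injective (fun k : int => (2%:R : K) ^ k).
Proof.
move=> /pcharf0P K0; have two0 : 2%:R != 0 :> K by rewrite K0.
suff pos (m : nat) : (2%:R : K) ^ m%:Z = 1 -> m = 0%N.
  suff one k : (2%:R : K) ^ k = 1 -> k = 0.
    move=> k l /= kl; apply: subr0_eq; apply: one.
    by rewrite expfzDr // kl -expfzDr // subrr.
  case: k => [m /pos -> //|m]; rewrite NegzE -invr_expz => /(congr1 GRing.inv).
  by rewrite invrK invr1 => /(pos m.+1).
rewrite -exprnP -natrX => /eqP.
have : (1 <= 2 ^ m)%N by rewrite expn_gt0.
move=> m1; rewrite -subr_eq0 -[X in _ - X]/(1%:R) -natrB // K0 subn_eq0.
by case: m {m1} => // m; rewrite leqNgt (ltn_exp2l 0).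
Qed.

Section PresentationBasis.
Variables (K : fieldType) (n : nat) (q : 'M[K]_n) (Q : algType K).
Hypothesis K0 : [pchar K] =i pred0.
Variables (x y : 'I_n -> Q).
Hypothesis qP : quantum_matrix q.
Hypothesis presQ : torus_presentation q x y.
Local Notation X := (torus_mono x y).
Local Notation "z ~ w" := (proportional z w) (at level 70).

(** The universal property maps [Q] to the generated subalgebra; followed by the inclusion, this
    fixes the generators and so is the identity by uniqueness. *)
Lemma presentation_generated (z : Q) : z \in generated x y.
Proof.
have [[xy yx qxy] univ] := presQ.
pose u i : generated_type x y := Generated (generated_genl x y i).
pose v i : generated_type x y := Generated (generated_genr x y i).
have uv : torus_relations q u v.
  split=> [i|i|i j]; apply: val_inj.
  - exact: (xy i).
  - exact: (yx i).
  - exact: (qxy i j).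
have [phi [phi_uv _]] := univ _ u v uv.
pose psi : {lrmorphism Q -> Q} := generated_incl (y:=y) \o phi.
have [id' [_ id_uniq]] := univ _ x y presQ.1.
have id_x i : idfun (x i) = x i /\ idfun (y i) = y i by [].
have psi_x i : psi (x i) = x i /\ psi (y i) = y i.
  by rewrite /= /generated_incl; case: (phi_uv i) => -> ->.
have -> : z = psi z by rewrite (id_uniq psi psi_x) -(id_uniq idfun id_x).
exact: generated_valP.
Qed.

Lemma presentation_ind (P : Q -> Prop) : P 1 ->
  (forall c u v, P u -> P v -> P (c *: u + v)) ->
  (forall u v, P u -> P v -> P (u * v)) -> (forall i, P (x i) /\ P (y i)) ->
  forall z, P z.
Proof.
move=> P1 Plin PM Pg z.
exact: (generatedP P1 Plin PM Pg (Generated (presentation_generated z))).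
Qed.

Lemma span_pairs (G : eqType) (V : lmodType K) (B : G -> V) (r : seq (K * G)) :
  exists (s : seq G) (c : G -> K),
    \sum_(p <- r) p.1 *: B p.2 = \sum_(a <- s) c a *: B a.
Proof.
exists (undup (map snd r)), (fun a => \sum_(p <- r | p.2 == a) p.1).
under [RHS]eq_bigr do rewrite scaler_suml.
rewrite (exchange_big_dep xpredT) //= !big_seq; apply: eq_bigr => p pr.
rewrite -big_filter (eq_filter (a2 := pred1 p.2)) => [|a]; last by rewrite /= eq_sym.
by rewrite filter_pred1_uniq ?undup_uniq ?big_seq1 // mem_undup map_f.
Qed.

Lemma presentation_span (z : Q) : exists (s : seq 'rV[int]_n) (c : 'rV[int]_n -> K),
  z = \sum_(a <- s) c a *: X a.
Proof.
have [q0 _ _] := qP.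
suff [r ->] : exists r : seq (K * 'rV[int]_n), z = \sum_(p <- r) p.1 *: X p.2.
  exact: span_pairs.
have one a : exists r : seq (K * 'rV[int]_n), X a = \sum_(p <- r) p.1 *: X p.2.
  by exists [:: (1, a)]; rewrite big_seq1 scale1r.
have lin (c : K) u v : (exists r : seq (K * 'rV[int]_n), u = \sum_(p <- r) p.1 *: X p.2) ->
    (exists r : seq (K * 'rV[int]_n), v = \sum_(p <- r) p.1 *: X p.2) ->
    exists r : seq (K * 'rV[int]_n), c *: u + v = \sum_(p <- r) p.1 *: X p.2.
  move=> [r ->] [r' ->]; exists (map (fun p => (c * p.1, p.2)) r ++ r').
  rewrite big_cat big_map scaler_sumr /=; congr (_ + _).
  by apply: eq_bigr => p _; rewrite scalerA.
elim/presentation_ind: z => [|c u v|u v [r ->] [r' ->]|i].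
- by have := one 0; rewrite torus_mono0.
- exact: lin.
- elim: r => [|p r IHr]; first by exists [::]; rewrite !big_nil mul0r.
  rewrite big_cons mulrDl -scalerAl; apply: (lin) => //.
  elim: r' {IHr} => [|p' r' IHr']; first by exists [::]; rewrite !big_nil mulr0.
  rewrite big_cons mulrDr -scalerAr; apply: (lin) => //.
  have [c c0 ->] := torus_monoM presQ.1 q0 p.2 p'.2.
  by exists [:: (c, p.2 + p'.2)]; rewrite big_seq1.
- have [oneD _] := (one (\row_j (if j == i then 1 else 0)), tt).
  have [oneN _] := (one (\row_j (if j == i then -1 else 0)), tt).
  rewrite !torus_mono_delta /= in oneD oneN.
  split; [exact: oneD|].
  by rewrite -[y i]expr1.
Qed.

(* These automorphisms separate the monomials, whence their independence. *)
Lemma presentation_scaling (i : 'I_n) : exists tau : {lrmorphism Q -> Q},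
  forall a, tau (X a) = (2%:R ^ a 0 i) *: X a.
Proof.
have [[xy yx qxy] univ] := presQ.
pose t j : K := if j == i then 2%:R else 1.
have t0 j : t j != 0 by rewrite /t; case: ifP; rewrite ?oner_eq0 // (pcharf0P _).1.
have rel : torus_relations q (fun j => t j *: x j) (fun j => (t j)^-1 *: y j).
  split=> [j|j|j k]; rewrite -scalerAl -scalerAr scalerA.
  - by rewrite xy divff // scale1r.
  - by rewrite yx mulVf // scale1r.
  - rewrite qxy -scalerAl -scalerAr !scalerA; congr (_ *: _).
    by rewrite mulrC [t j * t k]mulrC mulrA.
have [tau [tau_xy _]] := univ _ _ _ rel; exists tau => a.
have tau_pow j k : tau (torus_pow x y j k) = (t j) ^ k *: torus_pow x y j k.
  by case: k => k /=; rewrite rmorphXn /= ?(tau_xy j).1 ?(tau_xy j).2 exprZn ?exprVn.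
rewrite /torus_mono rmorph_prod (eq_bigr _ (fun j _ => tau_pow j (a 0 j))).
have -> (r : seq 'I_n) : \prod_(j <- r) (t j ^ a 0 j *: torus_pow x y j (a 0 j))
    = (\prod_(j <- r) t j ^ a 0 j) *: \prod_(j <- r) torus_pow x y j (a 0 j).
  elim: r => [|j r IHr]; first by rewrite !big_nil scale1r.
  by rewrite !big_cons IHr -scalerAl -scalerAr scalerA.
congr (_ *: _); rewrite (@prod_delta _ _ i) /t ?eqxx // => j /negbTE ->.
exact: exp1rz.
Qed.

Lemma presentation_free (s : seq 'rV[int]_n) (c : 'rV[int]_n -> K) : uniq s ->
  \sum_(a <- s) c a *: X a = 0 -> forall a, a \in s -> c a = 0.
Proof.
have [q0 _ _] := qP.
have X0 a : X a != 0.
  apply/negP=> /eqP Xa; have [d d0] := torus_monoM presQ.1 q0 a (- a).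
  by rewrite Xa mul0r subrr torus_mono0 => /esym/eqP; rewrite scaler_eq0 (negbTE d0) oner_eq0.
elim: s c => // a s IHs c /= /andP[as_ us] sum0.
have c0 b : b \in s -> c b = 0.
  move=> bs; have [i ai] : exists i, a 0 i != b 0 i.
    apply/existsP; apply: contraNT as_ => /existsPn ab.
    suff -> : a = b by [].
    by apply/rowP=> i; apply/eqP; have := ab i; rewrite negbK.
  have [tau tauX] := presentation_scaling i.
  have := congr1 tau sum0; rewrite raddf0 raddf_sum /= => tau0.
  (* Apply [tau] to the relation and subtract the eigenvalue of [X a] times the relation: the term
     at [a] disappears, while the one at [b] keeps a non-zero factor because [a] and [b] differ at
     [i]. *)
  have : \sum_(a' <- s) (c a' * (2%:R ^ a' 0 i - 2%:R ^ a 0 i)) *: X a' = 0.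
    have : \sum_(a' <- a :: s) tau (c a' *: X a')
        - (2%:R ^ a 0 i) *: (\sum_(a' <- a :: s) c a' *: X a') = 0.
      by rewrite tau0 sum0 scaler0 subr0.
    rewrite !big_cons linearZ /= tauX scalerDr !scalerA [_ * c a]mulrC opprD addrACA.
    rewrite subrr add0r scaler_sumr -sumrB => sumB; rewrite -[RHS]sumB.
    apply: eq_bigr => a' _; rewrite linearZ /= tauX !scalerA -scalerBl.
    by rewrite mulrBr [c a' * _ ^ a 0 i]mulrC.
  move/IHs => /(_ us b bs)/eqP; rewrite mulf_eq0 subr_eq0 => /orP[/eqP //|/eqP].
  by move/(pow2z_inj K0) => ab; rewrite ab eqxx in ai.
move=> b; rewrite inE => /predU1P[->|/c0 //]; move: sum0.
rewrite big_cons big_seq big1 ?addr0 => [/eqP|b' /c0 ->]; last by rewrite scale0r.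
by rewrite scaler_eq0 (negbTE (X0 a)) orbF => /eqP.
Qed.

Lemma presentation_basis : torus_basis X.
Proof.
have [q0 _ _] := qP; split.
- exact: torus_mono0.
- exact: torus_monoM presQ.1 q0.
- exact: presentation_free.
- exact: presentation_span.
Qed.

End PresentationBasis.

(** * Leading terms and commutation factors *)

Section LeadingTerms.
Variables (K : fieldType) (Q : algType K) (G : zmodType) (X : G -> Q).
Hypothesis XB : torus_basis X.
Local Notation tcoef := (tcoef XB).

Lemma tcoef_eq0 y : (forall a, tcoef y a = 0) -> y = 0.
Proof. by move=> y0; apply: (tcoef_inj (XB := XB)) => a; rewrite y0 tcoef0. Qed.

Lemma tcoefM_neq0 y z b : tcoef (y * z) b != 0 ->
  exists a1 a2, [/\ tcoef y a1 != 0, tcoef z a2 != 0 & b = a1 + a2].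
Proof.
move=> yz; case: (pselect (exists a1 a2,
  [/\ tcoef y a1 != 0, tcoef z a2 != 0 & b = a1 + a2])) => // no.
case/eqP: yz; rewrite [y in y * z](tcoefE XB) [z in _ * z](tcoefE XB) mulr_suml.
rewrite tcoef_sumr big_seq big1 // => a1; rewrite mem_supp => ya1.
rewrite mulr_sumr tcoef_sumr big_seq big1 // => a2; rewrite mem_supp => za2.
have [c _ XX] := tbM XB a1 a2.
rewrite -scalerAl -scalerAr XX !tcoefZ tcoefX; case: eqP => [ba|_]; last by rewrite !mulr0.
by case: no; exists a1, a2.
Qed.

Section Order.
Variable pos : pred G.
Hypothesis ord : translation_order pos.

(** Since [pos 0] fails, the case [b = a] of the second clause forces [c] to be the coefficient of
    [y] at [a]; the other cases put all other exponents of [y] below [a]. *)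
Definition leading (y : Q) (a : G) (c : K) : Prop :=
  c != 0 /\ forall b, tcoef (y - c *: X a) b != 0 -> pos (a - b).

Lemma leading_coef y a c : leading y a c -> tcoef y a = c.
Proof.
have [_ _ pos0] := ord; case=> c0 low; apply/eqP; apply: contraNT pos0 => yc.
rewrite -(subrr a); apply: low; rewrite tcoefD tcoefN tcoefZ tcoefX eqxx mulr1.
by rewrite subr_eq0.
Qed.

Lemma leading_max y a c b : leading y a c -> tcoef y b != 0 -> b = a \/ pos (a - b).
Proof.
case=> c0 low yb; case: (eqVneq b a) => [|ba]; [by left|right; apply: low].
by rewrite tcoefD tcoefN tcoefZ tcoefX (negbTE ba) mulr0 subr0.
Qed.

Lemma leading_neq0 y a c : leading y a c -> y != 0.
Proof.
move=> ld; apply/eqP=> y0; have := leading_coef ld; case: ld => /eqP c0 _.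
by rewrite y0 tcoef0 => /esym.
Qed.

Lemma leading_uniq y a c a' c' : leading y a c -> leading y a' c' -> a = a' /\ c = c'.
Proof.
have [posD _ pos0] := ord; move=> ld ld'.
have c0 := leading_coef ld; have c0' := leading_coef ld'.
suff aa : a = a' by split=> //; rewrite -c0 -c0' aa.
have ya : tcoef y a != 0 by rewrite c0; case: ld.
have ya' : tcoef y a' != 0 by rewrite c0'; case: ld'.
case: (leading_max ld' ya) => // p; case: (leading_max ld ya') => // p'.
by case/negP: pos0; rewrite -(subrr a') -[_ - _](subrKA a); exact: posD.
Qed.

Lemma leading_monomial a c : c != 0 -> leading (c *: X a) a c.
Proof. by move=> c0; split=> // b; rewrite subrr tcoef0 eqxx. Qed.

Lemma leading_exists y : y != 0 -> exists a c, leading y a c.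
Proof.
have [posD posT pos0] := ord; move=> y0.
have max (s : seq G) : s != [::] ->
    exists2 a, a \in s & forall b, b \in s -> b = a \/ pos (a - b).
  elim: s => // a s IHs _; case: (eqVneq s [::]) => [->|/IHs[a' a's a'max]].
    by exists a; rewrite ?inE // => b; rewrite inE => /eqP; left.
  case: (eqVneq a a') => [->|aa'].
    exists a' => [|b]; rewrite inE ?eqxx // => /predU1P[->|/a'max //]; by left.
  have /orP[p|p] : pos (a - a') || pos (- (a - a')) by apply: posT; rewrite subr_eq0.
    exists a => [|b]; rewrite inE ?eqxx // => /predU1P[->|/a'max []]; first by left.
      by move=> ->; right.
    by move=> p'; right; rewrite -(subrKA a'); exact: posD.
  exists a' => [|b]; rewrite inE ?a's ?orbT // => /predU1P[->|/a'max //].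
  by right; rewrite -opprB.
have [|a ys amax] := max (supp XB y).
  apply: contraNneq y0 => s0; apply/eqP; apply: tcoef_eq0 => a.
  by apply/eqP; rewrite -[_ == _]negbK -mem_supp s0.
exists a, (tcoef y a); rewrite mem_supp in ys; split=> // b.
rewrite tcoefD tcoefN tcoefZ tcoefX; case: (eqVneq b a) => [->|ba].
  by rewrite mulr1 [tcoef _ _ - _]subrr eqxx.
by rewrite mulr0 subr0 -mem_supp => /amax[/eqP|//]; rewrite (negbTE ba).
Qed.

Lemma leadingM y z a b c d s : X a * X b = s *: X (a + b) ->
  leading y a c -> leading z b d -> leading (y * z) (a + b) (c * d * s).
Proof.
have [posD _ pos0] := ord; move=> XX ldy ldz; have [c0 lowy] := ldy; have [d0 lowz] := ldz.
have s0 : s != 0.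
  have [s' s'0 XX'] := tbM XB a b; apply: contraTneq isT => s0.
  move: XX; rewrite s0 scale0r XX' => /eqP.
  by rewrite scaler_eq0 (negbTE s'0) (negbTE (tb_neq0 XB _)).
split; first by rewrite !mulf_neq0.
move=> e; have -> : y * z - (c * d * s) *: X (a + b)
    = (y - c *: X a) * z + c *: X a * (z - d *: X b).
  have -> : (c * d * s) *: X (a + b) = c *: X a * (d *: X b).
    by rewrite -scalerAl -scalerAr XX !scalerA.
  by rewrite mulrBl mulrBr addrA subrK.
rewrite tcoefD; case: (eqVneq (tcoef ((y - c *: X a) * z) e) 0) => [->|].
  rewrite add0r => /tcoefM_neq0[a1 [a2 [a1n /lowz p ->]]].
  have -> : a1 = a.
    by apply/eqP; apply: contraNT a1n => /negbTE a1a; rewrite tcoefZ tcoefX a1a mulr0.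
  by rewrite opprD addrACA subrr add0r.
case/tcoefM_neq0=> a1 [a2 [/lowy p a2n ->]] _; rewrite opprD addrACA.
case: (leading_max ldz a2n) => [->|p']; first by rewrite subrr addr0.
exact: posD.
Qed.

Lemma leadingM_exists y z a b c d : leading y a c -> leading z b d ->
  exists e, leading (y * z) (a + b) e.
Proof.
by move=> ly lz; have [s _ XX] := tbM XB a b; exists (c * d * s); apply: leadingM.
Qed.

Lemma basis_domain (y z : Q) : y != 0 -> z != 0 -> y * z != 0.
Proof.
move=> /leading_exists[a [c ly]] /leading_exists[b [d lz]].
by have [e /leading_neq0] := leadingM_exists ly lz.
Qed.

(** Keeping the coefficient with the monomial makes leading terms multiplicative as elements of [Q],
    with no twisting scalar to carry along. *)
Definition leading_term (y m : Q) : Prop := exists a c, leading y a c /\ m = c *: X a.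

Lemma leading_term_exists y : y != 0 -> exists m, leading_term y m.
Proof. by move=> /leading_exists[a [c ly]]; exists (c *: X a), a, c. Qed.

Lemma leading_termM y z m p : leading_term y m -> leading_term z p ->
  leading_term (y * z) (m * p).
Proof.
move=> [a [c [ly ->]]] [b [d [lz ->]]]; have [s _ XX] := tbM XB a b.
exists (a + b), (c * d * s); split; first exact: leadingM.
by rewrite -scalerAl -scalerAr XX !scalerA.
Qed.

Lemma leading_term_uniq y m p : leading_term y m -> leading_term y p -> m = p.
Proof.
by move=> [a [c [ly ->]]] [b [d [/(leading_uniq ly)[-> ->] ->]]].
Qed.

End Order.

(** The highest exponents of [y] and [z] add up to 0, and so do the lowest ones. The spread of [y]
    is therefore minus the spread of [z]; as neither can be negative, [y] has a single term. *)
Lemma unit_monomial (pos : pred G) (y z : Q) : translation_order pos ->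
  y * z = 1 -> exists2 c, c != 0 & exists a, y = c *: X a.
Proof.
move=> ord yz; have ord' := translation_order_opp ord; have [posD posT pos0] := ord.
have y0 : y != 0.
  by apply: contra_eq_neq yz => ->; rewrite mul0r eq_sym oner_neq0.
have z0 : z != 0.
  by apply: contra_eq_neq yz => ->; rewrite mulr0 eq_sym oner_neq0.
have [a [c ly]] := leading_exists ord y0; have [b [d lz]] := leading_exists ord z0.
have [a' [c' ly']] := leading_exists ord' y0; have [b' [d' lz']] := leading_exists ord' z0.
have ab : a + b = 0.
  have [e] := leadingM_exists ord ly lz; rewrite yz -(tb0 XB) -[X 0]scale1r => le.
  by have [] := leading_uniq ord le (leading_monomial pos 0 (oner_neq0 _)).
have ab' : a' + b' = 0.
  have [e] := leadingM_exists ord' ly' lz'; rewrite yz -(tb0 XB) -[X 0]scale1r => le.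
  by have [] := leading_uniq ord' le (leading_monomial (fun a => pos (- a)) 0 (oner_neq0 _)).
have bb' : b - b' = - (a - a').
  by rewrite -[b](addKr a) ab -[b'](addKr a') ab' !addr0 opprK opprB addrC.
have ya' : tcoef y a' != 0 by rewrite (leading_coef ord' ly'); case: ly'.
have zb' : tcoef z b' != 0 by rewrite (leading_coef ord' lz'); case: lz'.
have aa' : a' = a.
  case: (leading_max ly ya') => // p; case: (leading_max lz zb') => [bb|].
    by case/negP: pos0; move/eqP: bb'; rewrite bb subrr eq_sym oppr_eq0 => /eqP <-.
  by rewrite bb' => p'; case/negP: pos0; rewrite -(subrr (a - a')); exact: posD.
exists c; first by case: ly.
exists a; apply/eqP; rewrite -subr_eq0; apply/eqP; apply: tcoef_eq0 => e.
apply/eqP; apply: contraNT pos0 => le; have pe := ly.2 e le.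
have : tcoef y e != 0.
  move: le; rewrite tcoefD tcoefN tcoefZ tcoefX.
  case: (eqVneq e a) => [->|_]; last by rewrite mulr0 subr0.
  by rewrite (leading_coef ord ly) mulr1 subrr eqxx.
case/(leading_max ly') => [ea|pe'].
  by rewrite ea aa' subrr in pe.
by rewrite -(subrr (a - e)) -{2}aa'; exact: posD.
Qed.

(** Both products are non-zero multiples of [X (a + b)], so the quotient of the two coefficients is
    the bicharacter of the torus; [commutation_uniq] and [commutationE] characterise it. *)
Definition commutation (a b : G) : K :=
  tcoef (X a * X b) (a + b) / tcoef (X b * X a) (a + b).
Local Notation beta := commutation.

Lemma commutation_uniq a b k : X a * X b = k *: (X b * X a) -> beta a b = k.
Proof.
rewrite /beta => ->; have [d d0 ->] := tbM XB b a.
by rewrite !tcoefZ tcoefX addrC eqxx mulr1 mulfK.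
Qed.

Lemma commutationE a b : X a * X b = beta a b *: (X b * X a).
Proof.
have [c c0 E] := tbM XB a b; have [d d0 E'] := tbM XB b a.
suff E2 : X a * X b = (c / d) *: (X b * X a) by rewrite (commutation_uniq E2).
by rewrite E E' scalerA mulfVK // addrC.
Qed.

Lemma commutation_neq0 a b : beta a b != 0.
Proof.
have [c c0 E] := tbM XB a b; apply: contraTneq isT => b0.
have /eqP := commutationE a b; rewrite b0 scale0r E scaler_eq0.
by rewrite (negbTE c0) (negbTE (tb_neq0 XB _)).
Qed.

Lemma commutationDl a a' b : beta (a + a') b = beta a b * beta a' b.
Proof.
apply: commutation_uniq; have [s s0 XX] := tbM XB a a'.
have : X a * X a' * X b = (beta a b * beta a' b) *: (X b * (X a * X a')).
  rewrite -mulrA (commutationE a' b) -scalerAr [X a * (X b * _)]mulrA (commutationE a b) -scalerAl.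
  by rewrite scalerA -[X b * X a * _]mulrA [beta a' b * _]mulrC.
rewrite XX -scalerAl -scalerAr scalerA [_ * s]mulrC -scalerA => /(scalerI s0) ->.
by [].
Qed.

Lemma commutation_sym a b : beta b a = (beta a b)^-1.
Proof.
apply: commutation_uniq; rewrite [X a * X b]commutationE scalerA.
by rewrite mulVf ?commutation_neq0 ?scale1r.
Qed.

Lemma commutationDr a b b' : beta a (b + b') = beta a b * beta a b'.
Proof. by rewrite commutation_sym commutationDl invfM -!commutation_sym. Qed.

Lemma commutation0l b : beta 0 b = 1.
Proof. by apply: commutation_uniq; rewrite scale1r (tb0 XB) mulr1 mul1r. Qed.

Lemma commutationNl a b : beta (- a) b = (beta a b)^-1.
Proof.
apply: (mulfI (commutation_neq0 a b)).
by rewrite -commutationDl subrr commutation0l divff ?commutation_neq0.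
Qed.

(** The exponents of the central monomials, by [radical_central] and [central_radical]. *)
Definition radical (a : G) : Prop := forall b, beta a b = 1.

Lemma radicalN a : radical a -> radical (- a).
Proof. by move=> ra e; rewrite commutationNl ra invr1. Qed.

Lemma radical_central a : radical a -> forall z, X a * z = z * X a.
Proof.
move=> ra z; rewrite (tcoefE XB z) mulr_sumr mulr_suml; apply: eq_bigr => b _.
by rewrite -scalerAr -scalerAl commutationE ra scale1r.
Qed.

Lemma central_radical a c : c != 0 -> (forall z, c *: X a * z = z * (c *: X a)) ->
  radical a.
Proof.
move=> c0 cen b; apply: commutation_uniq; rewrite scale1r; apply: (scalerI c0).
by have := cen (X b); rewrite -scalerAl -scalerAr.
Qed.

End LeadingTerms.

(** * The rank condition *)

(* Bernoulli's inequality for M / (M + e), multiplied out. *)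
Lemma bernoulli_nat (M e n : nat) :
  ((M + e) ^ n * (M + e) <= M ^ n * (M + e) + e * n * (M + e) ^ n)%N.
Proof.
set T := (M + e)%N; elim: n => [|n IHn]; first by rewrite muln0 mul0n addn0.
have MT : (M ^ n <= T ^ n)%N by case: n {IHn} => // n; rewrite leq_exp2r ?leq_addr.
rewrite expnS -mulnA; apply: leq_trans (leq_mul (leqnn T) IHn) _.
have -> : (T * (M ^ n * T + e * n * T ^ n) =
           M ^ n.+1 * T + (e * (M ^ n * T) + e * n * (T ^ n * T)))%N.
  rewrite expnS mulnDr {1}/T mulnDl -addnA; congr (_ + (_ + _))%N.
    by rewrite mulnA.
  by rewrite mulnCA [(T * _)%N]mulnC.
rewrite leq_add2l [(e * n.+1)%N]mulnS mulnDl [(T * T ^ n)%N]mulnC leq_add2r.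
by rewrite !leq_mul.
Qed.

Lemma box_growth (l n d : nat) : exists m : nat,
  (l * (2 * (m + d)).+1 ^ n < l.+1 * (2 * m).+1 ^ n)%N.
Proof.
(* Bernoulli bounds the relative loss from the larger box to the smaller one by [2 d n / T].
   Multiplied by [l.+1] this is [2 m / T], which is less than 1 for this [m]. *)
exists (l.+1 * (d * n))%N; set m := (l.+1 * (d * n))%N.
have := bernoulli_nat (2 * m).+1 (2 * d) n.
rewrite addSn -mulnDr; set T := (2 * (m + d)).+1; set M := (2 * m).+1 => bern.
have T0 : (0 < T ^ n)%N by rewrite expn_gt0.
rewrite ltnNge; apply/negP=> le.
have : (l.+1 * (T ^ n * T) <= l * (T ^ n * T) + 2 * m * T ^ n)%N.
  apply: leq_trans (leq_mul (leqnn l.+1) bern) _; rewrite mulnDr leq_add //.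
    by rewrite !mulnA leq_mul2r le orbT.
  by rewrite /m !mulnA [(l.+1 * 2)%N]mulnC.
rewrite mulSn addnC leq_add2l mulnC leq_pmul2r // /T ltnNge.
by rewrite leq_mul2l leq_addr.
Qed.

Definition in_box (n m : nat) (a : 'rV[int]_n) : Prop := forall i, (`|a 0%R i| <= m)%N.

Lemma in_box_seq (n : nat) (s : seq 'rV[int]_n) :
  exists d, forall a, a \in s -> in_box d a.
Proof.
elim: s => [|a s [d sd]]; first by exists 0%N.
exists (d + \max_i `|a 0%R i|%N)%N => b; rewrite inE => /predU1P[->|/sd bd] i.
  apply: leq_trans (leq_addl d _).
  exact: (@leq_bigmax _ (fun i => `|a 0%R i|%N) i).
exact: leq_trans (bd i) (leq_addr _ _).
Qed.

Lemma in_boxD (n m p : nat) (a b : 'rV[int]_n) :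
  in_box m a -> in_box p b -> in_box (m + p) (a + b).
Proof.
move=> ma pb i; rewrite mxE; apply: leq_trans (leq_add (ma i) (pb i)).
by rewrite -lez_nat PoszD !abszE ler_normD.
Qed.

Definition box_point (n m : nat) (g : {ffun 'I_n -> 'I_(2 * m).+1}) : 'rV[int]_n :=
  \row_i ((g i)%:Z - m%:Z).

Lemma box_point_inj (n m : nat) : injective (@box_point n m).
Proof.
move=> g h /rowP gh; apply/ffunP=> i; apply/val_inj; have := gh i.
by rewrite !mxE => /addIr [].
Qed.

Lemma box_point_box (n m : nat) g : in_box m (@box_point n m g).
Proof.
move=> i; rewrite mxE -lez_nat abszE ler_norml lerBrDr lerBlDr addNr lez_nat leq0n /=.
by rewrite -PoszD lez_nat addnn -mul2n -ltnS ltn_ord.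
Qed.

Lemma box_pointP (n m : nat) (a : 'rV[int]_n) : in_box m a -> exists g, a = box_point (m := m) g.
Proof.
move=> am; exists [ffun i => inord (absz (a 0 i + m%:Z))]; apply/rowP=> i.
have := am i; rewrite -lez_nat abszE ler_norml => /andP[a1 a2].
have am0 : 0 <= a 0 i + m%:Z by rewrite -lerBlDr sub0r.
rewrite mxE ffunE inordK ?gez0_abs // ?addrK //.
by rewrite ltnS -lez_nat gez0_abs // mul2n -addnn PoszD lerD2r.
Qed.

Section RankCondition.
Variables (K : fieldType) (Q : algType K) (n : nat) (X : 'rV[int]_n -> Q).
Hypothesis XB : torus_basis X.
Local Notation coef := (tcoef XB).

(** Look for [c] with entries supported in the box of radius [m]. If the entries of [A] lie in the
    box of radius [d], then [A *m c] lives in the box of radius [m + d], and for the [m] of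
    [box_growth] there are more unknown coefficients than linear equations over [K]. *)
Lemma rank_condition (l : nat) (A : 'M[Q]_(l, l.+1)) :
  exists2 c : 'cV[Q]_(l.+1), c != 0 & A *m c = 0.
Proof.
have [d dbox] := in_box_seq
  (flatten (codom (fun kj : 'I_l * 'I_l.+1 => supp XB (A kj.1 kj.2)))).
have Abox k j a : coef (A k j) a != 0 -> in_box d a.
  move=> Aa; apply: dbox; apply/flattenP; exists (supp XB (A k j)); last by rewrite mem_supp.
  exact: (codom_f (fun kj : 'I_l * 'I_l.+1 => supp XB (A kj.1 kj.2)) (k, j)).
have [m m_growth] := box_growth l n d.
pose I : finType := ('I_l.+1 * {ffun 'I_n -> 'I_(2 * m).+1})%type.
pose J : finType := ('I_l * {ffun 'I_n -> 'I_(2 * (m + d)).+1})%type.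
(* Rows stand for the unknown coefficients and columns for the equations, so a solution is a vector
   of the left kernel. *)
pose T : 'M[K]_(#|I|, #|J|) := \matrix_(r, s)
  coef (A (enum_val s).1 (enum_val r).1 * X (box_point (enum_val r).2))
    (box_point (enum_val s).2).
have ker0 : kermx T != 0.
  rewrite -mxrank_eq0 mxrank_ker subn_eq0 -ltnNge.
  apply: leq_ltn_trans (rank_leq_col T) _.
  by rewrite !card_prod !card_ffun !card_ord.
have [i vi] : exists i, row i (kermx T) != 0.
  apply/existsP; apply: contraNT ker0 => /existsPn ker0; apply/eqP/row_matrixP=> i.
  by rewrite row0; apply/eqP; have := ker0 i; rewrite negbK.
pose v := row i (kermx T).
have vT : v *m T = 0 by rewrite /v -row_mul mulmx_ker row0.
pose c : 'cV[Q]_(l.+1) := \col_j \sum_g v 0 (enum_rank ((j, g) : I)) *: X (box_point g).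
exists c.
  apply: contraNneq vi => c0; apply/eqP/rowP=> r; rewrite [RHS]mxE -[LHS]/(v 0 r).
  have /(congr1 (fun y => coef y (box_point (enum_val r).2))) :
    c (enum_val r).1 0 = 0 by rewrite c0 mxE.
  rewrite mxE tcoef0 tcoef_sumr (bigD1 (enum_val r).2) //= big1 ?addr0 => [|g /negbTE gr].
    by rewrite tcoefZ tcoefX eqxx mulr1 -surjective_pairing enum_valK.
  by rewrite tcoefZ tcoefX (inj_eq (@box_point_inj _ _)) eq_sym gr mulr0.
apply/matrixP=> k z; rewrite [RHS]mxE ord1 {z}; apply: (tcoef_eq0 (XB := XB)) => b.
have E : coef ((A *m c) k 0) b = \sum_(r : I) v 0 (enum_rank r) *
    coef (A k r.1 * X (box_point r.2)) b.
  transitivity (\sum_j \sum_g v 0 (enum_rank ((j, g) : I)) * coef (A k j * X (box_point g)) b).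
    2: by rewrite pair_bigA; apply: eq_bigr => -[].
  rewrite mxE tcoef_sumr; apply: eq_bigr => j _.
  rewrite mxE mulr_sumr tcoef_sumr; apply: eq_bigr => g _.
  by rewrite -scalerAr tcoefZ.
rewrite {}E; have [bbox|nbox] := pselect (in_box (m + d) b); last first.
  rewrite big1 // => -[j g] _ /=; case: (eqVneq (coef (A k j * X (box_point g)) b) 0) => [->|].
    by rewrite mulr0.
  case/tcoefM_neq0=> a1 [a2 [/Abox a1d]]; rewrite tcoefX.
  case: (eqVneq a2 (box_point g)) => [->|_ /eqP //] _ bE.
  by case: nbox; rewrite bE addrC; apply: in_boxD => //; exact: box_point_box.
have [g ->] := box_pointP bbox.
transitivity ((v *m T) 0 (enum_rank ((k, g) : J))); last by rewrite vT mxE.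
rewrite [RHS]mxE [RHS](reindex (@enum_rank I)); last first.
  by exists enum_val => r _; rewrite ?enum_rankK ?enum_valK.
by apply: eq_bigr => r _; rewrite [T _ _]mxE !enum_rankK.
Qed.

End RankCondition.

(** * Bicharacters on lattices *)

Section Bicharacters.
Variables (K : fieldType) (G : zmodType).

Definition bicharacter (b : G -> G -> K) : Prop :=
  [/\ forall x y, b x y != 0, forall x x' y, b (x + x') y = b x y * b x' y
    & forall x y y', b x (y + y') = b x y * b x y'].

Lemma character_mulz (h : G -> K) : (forall x, h x != 0) ->
  (forall x y, h (x + y) = h x * h y) -> forall x k, h (x *~ k) = h x ^ k.
Proof.
move=> h0 hD; have hz : h 0 = 1.
  by apply: (mulfI (h0 0)); rewrite -hD addr0 mulr1.
have hM x (m : nat) : h (x *+ m) = h x ^+ m.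
  by elim: m => [|m IHm]; rewrite ?mulr0n // mulrS hD IHm exprS.
move=> x [m|m] /=; first exact: hM.
apply: (mulfI (h0 (x *+ m.+1))).
by rewrite -hD NegzE mulrNz subrr hz -invr_expz hM divff // expf_neq0.
Qed.

Lemma character_sum (h : G -> K) (I : Type) (r : seq I) (F : I -> G) :
  (forall x, h x != 0) -> (forall x y, h (x + y) = h x * h y) ->
  h (\sum_(i <- r) F i) = \prod_(i <- r) h (F i).
Proof.
move=> h0 hD; apply: (big_morph h hD).
by apply: (mulfI (h0 0)); rewrite -hD addr0 mulr1.
Qed.

Lemma characterB (h : G -> K) x y : (forall x, h x != 0) ->
  (forall x y, h (x + y) = h x * h y) -> h (x - y) = h x / h y.
Proof. by move=> h0 hD; apply: (mulIf (h0 y)); rewrite -hD subrK mulfVK. Qed.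

(** If [x] is outside [P] and [y] is in [P], then [x] and [x - y] are both outside [P], hence in
    [R], and so is [y]. *)
Lemma subgroup_cover (P R : G -> Prop) :
  (forall x y, P x -> P y -> P (x - y)) -> (forall x y, R x -> R y -> R (x - y)) ->
  (forall x, P x \/ R x) -> (forall x, P x) \/ (forall x, R x).
Proof.
move=> PB RB PR; have [allP|/existsNP[x nPx]] := pselect (forall x, P x); first by left.
right=> y; case: (PR y) => // Py; have Rx : R x by case: (PR x).
have PN : P (- y) by rewrite -sub0r; apply: (PB) => //; rewrite -(subrr y); exact: PB.
case: (PR (x - y)) => [Pxy|Rxy].
  by case: nPx; rewrite -(subrK y x) -[y in _ + y]opprK; exact: PB.
by rewrite -[y](subKr x); exact: RB.
Qed.

(** [subgroup_cover] is used twice: for fixed [x] it makes the sign independent of [y], and then it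
    makes the sign independent of [x]. *)
Lemma bicharacter_uniform_sign (b1 b2 : G -> G -> K) :
  bicharacter b1 -> bicharacter b2 ->
  (forall x y, b1 x y = b2 x y \/ b1 x y = (b2 x y)^-1) ->
  (forall x y, b1 x y = b2 x y) \/ (forall x y, b1 x y = (b2 x y)^-1).
Proof.
move=> [n1 l1 r1] [n2 l2 r2] b12; apply: subgroup_cover => [x x' e e' y|x x' e e' y|x].
- rewrite (@characterB (fun x => b1 x y)) ?(@characterB (fun x => b2 x y)) //.
  by rewrite e e'.
- rewrite (@characterB (fun x => b1 x y)) ?(@characterB (fun x => b2 x y)) //.
  by rewrite e e' invfM.
- apply: subgroup_cover => [y y' e e'|y y' e e'|y]; last exact: b12.
  + by rewrite !characterB // e e'.
  + by rewrite !characterB // e e' invfM.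
Qed.

End Bicharacters.

(* Moving powers of [theta] across [b] turns the characteristic equation of
   [theta] into the one with the coefficients reversed, whose constant term is 1:
   modulo the radical, every element is thus a value of [theta]. *)
Lemma isometry_surjective (K : fieldType) (n : nat)
    (b : 'rV[int]_n -> 'rV[int]_n -> K) (theta : 'rV[int]_n -> 'rV[int]_n) :
  bicharacter b -> (forall x y, theta (x + y) = theta x + theta y) ->
  (forall x y, b (theta x) (theta y) = b x y) ->
  (forall r, (forall x, b x r = 1) -> exists x, theta x = r) ->
  forall y, exists x, theta x = y.
Proof.
case: n b theta => [|n] b theta [b0 bl br] thetaD theta_b theta_rad y.
  by exists 0; rewrite [LHS]thinmx0 [RHS]thinmx0.
have theta0 : theta 0 = 0 by apply: (addrI (theta 0)); rewrite -thetaD !addr0.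
have thetaN x : theta (- x) = - theta x.
  by apply: (addrI (theta x)); rewrite -thetaD !subrr theta0.
have thetaz x k : theta (x *~ k) = theta x *~ k.
  have thetaM (m : nat) : theta (x *+ m) = theta x *+ m.
    by elim: m => [|m IHm]; rewrite ?mulr0n // !mulrS thetaD IHm.
  case: k => m; first exact: thetaM.
  by rewrite NegzE !mulrNz thetaN; congr (- _); exact: thetaM.
have thetas (r : seq nat) (F : nat -> 'rV[int]_n.+1) :
    theta (\sum_(i <- r) F i) = \sum_(i <- r) theta (F i).
  exact: (big_morph theta thetaD theta0).
have zE (k : int) (v : 'rV[int]_n.+1) : k *: v = v *~ k by rewrite -scaler_int intz.
pose M : 'M[int]_n.+1 := \matrix_i theta (delta_mx 0 i).
have thetaM x : theta x = x *m M.
  rewrite [in LHS](row_sum_delta x) (big_morph theta thetaD theta0) mulmx_sum_row.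
  by apply: eq_bigr => i _; rewrite rowK !zE thetaz.
have iterM x i : iter i theta x = x *m M ^+ i.
  elim: i => [|i IHi]; first by rewrite expr0 mulmx1.
  by rewrite iterS IHi thetaM exprSr mulmxA.
pose p := char_poly M; have sp : size p = n.+2 by rewrite size_char_poly.
have pn : p`_n.+1 = 1.
  by have /monicP := char_poly_monic M; rewrite lead_coefE -/p sp.
have cayley x : \sum_(0 <= i < n.+2) iter i theta x *~ p`_i = 0.
  transitivity (x *m horner_mx M p); last by rewrite Cayley_Hamilton mulmx0.
  rewrite -[in RHS](coefK p) poly_def sp linear_sum /= mulmx_sumr big_mkord.
  by apply: eq_bigr => i _; rewrite linearZ /= rmorphXn /= horner_mx_X iterM -scalemxAr zE.
have adj i m x z : (i <= m)%N ->
    b x (iter (m - i) theta z) = b (iter i theta x) (iter m theta z).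
  move=> im; rewrite -{2}(subnKC im) iterD.
  move: (iter (m - i) theta z) => {im} t.
  by elim: i => // i IHi; rewrite !iterS theta_b.
(* The reversed characteristic polynomial of [theta] applied to [y]; its last term is [y] itself
   because [p] is monic. By [adj], pairing [x] with [w] amounts to pairing the vanishing sum of
   [cayley] with [iter n.+1 theta y]. *)
pose w := \sum_(0 <= i < n.+2) iter (n.+1 - i) theta y *~ p`_i.
have rad_w x : b x w = 1.
  pose t := iter n.+1 theta y.
  have mulzl z k : b (z *~ k) t = b z t ^ k.
    exact: (@character_mulz _ _ (fun z => b z t) (b0^~ t) (fun z z' => bl z z' t)).
  have suml (r : seq nat) (F : nat -> 'rV[int]_n.+1) :
      b (\sum_(i <- r) F i) t = \prod_(i <- r) b (F i) t.
    exact: (@character_sum _ _ (fun z => b z t) nat r F (b0^~ t) (fun z z' => bl z z' t)).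
  rewrite /w (@character_sum _ _ (b x)) //.
  transitivity (\prod_(0 <= i < n.+2) b (iter i theta x *~ p`_i) t).
    rewrite !big_seq; apply: eq_bigr => i /[!mem_index_iota] /andP[_ im].
    by rewrite (@character_mulz _ _ (b x)) // mulzl (adj i n.+1 x y).
  rewrite -suml cayley.
  by apply: (mulfI (b0 0 t)); rewrite -bl addr0 mulr1.
have [r rw] := theta_rad w rad_w.
(* All terms of [w] except the last, with one application of [theta] removed: [w] is [theta S + y],
   and [w] is itself a value of [theta]. *)
pose S := \sum_(0 <= i < n.+1) iter (n - i) theta y *~ p`_i.
have thetaS : theta S = \sum_(0 <= i < n.+1) iter (n.+1 - i) theta y *~ p`_i.
  rewrite thetas !big_seq; apply: eq_bigr => i /[!mem_index_iota] /andP[_ im].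
  by rewrite thetaz subSn.
exists (r - S); rewrite thetaD thetaN rw thetaS /w big_nat_recr //= subnn pn.
by rewrite [X in X - _]addrC addrK.
Qed.

(** * Matrix Lie algebras *)

Lemma iter_commutator (R : pzRingType) (e y : R) (m : nat) :
  iter m (fun z => e * z - z * e) y =
  \sum_(i < m.+1) ((-1) ^+ i * (e ^+ (m - i) * y * e ^+ i)) *+ 'C(m, i).
Proof.
elim: m => [|m IHm]; first by rewrite big_ord1 !mul1r mulr1.
pose u i : R := (-1) ^+ i * (e ^+ (m.+1 - i) * y * e ^+ i).
rewrite iterS IHm mulr_sumr mulr_suml.
have -> : \sum_(i < m.+1) e * ((-1) ^+ i * (e ^+ (m - i) * y * e ^+ i) *+ 'C(m, i))
    = \sum_(i < m.+2) u i *+ 'C(m, i).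
  rewrite [RHS]big_ord_recr /= bin_small // mulr0n addr0; apply: eq_bigr => i _.
  rewrite mulrnAr /u subSn -1?ltnS // exprS; congr (_ *+ _).
  by rewrite mulrA (commr_sign e i) -!mulrA.
rewrite [RHS]big_ord_recl [X in X - _]big_ord_recl -addrA.
congr (_ + _); first by rewrite !bin0.
rewrite -sumrB; apply: eq_bigr => i _; rewrite /= /bump add1n binS mulrnDr; congr (_ + _).
rewrite mulrnAl -mulNrn exprS mulN1r mulNr subSS; congr (- _ *+ _).
by rewrite -!mulrA -exprSr.
Qed.

(** In every term of the binomial expansion the two exponents of [e] add up to [2 r], so unless both
    equal [r] one of them exceeds [r]. *)
Lemma iter_commutator_middle (R : pzRingType) (e y : R) (r : nat) : e ^+ r.+1 = 0 ->
  iter (r + r) (fun z => e * z - z * e) y =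
  ((-1) ^+ r * (e ^+ r * y * e ^+ r)) *+ 'C(r + r, r).
Proof.
move=> e0; have eN m : (r < m)%N -> e ^+ m = 0.
  by move=> rm; rewrite -(subnKC rm) exprD e0 mul0r.
have rr : (r < (r + r).+1)%N by rewrite ltnS leq_addr.
rewrite iter_commutator (bigD1 (Ordinal rr)) //= addnK big1 ?addr0 // => i ir.
case: (ltngtP r i) => [ri|ri|ri].
- by rewrite (eN _ ri) !mulr0 mul0rn.
- by rewrite (eN (_ - _)%N) ?mul0r ?mulr0 ?mul0rn // ltn_subRL addnC ltn_add2l.
- by case/eqP: ir; apply: val_inj.
Qed.

Identity Coercion gl_matrix : gl >-> matrix.

(** The Lie-theoretic argument also needs associative products and powers. The ring may be trivial,
    since the size [l] may be zero. *)
HB.instance Definition _ (K : fieldType) (A : algType K) (l : nat) :=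
  GRing.PzRing.copy (gl A l) 'M[A]_l.

Section GlAlgebra.
Variables (K : fieldType) (A : algType K) (l : nat).
Implicit Types (x y z : gl A l) (i j k m : 'I_l) (a b : A) (c : K).

Lemma gl_lieE x y : lie x y = x * y - y * x.
Proof. by []. Qed.

Lemma gl_scaleE c x i j : (c *: x) i j = c *: x i j.
Proof. by rewrite mxE. Qed.

Lemma gl_mulE x y i j : (x * y) i j = \sum_k x i k * y k j.
Proof. by rewrite mxE. Qed.

Lemma gl_scaleAl c x y : c *: (x * y) = (c *: x) * y.
Proof. by have := gl_mulmxl c x 0 y; rewrite addr0 mul0mx [X in _ = X]addr0 => /esym. Qed.

Lemma gl_scaleAr c x y : c *: (x * y) = x * (c *: y).
Proof. by have := gl_mulmxr c y 0 x; rewrite addr0 mulmx0 [X in _ = X]addr0 => /esym. Qed.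

Lemma lie_mul x y z : lie x (y * z) = lie x y * z + y * lie x z.
Proof. by rewrite !gl_lieE mulrBl mulrBr !mulrA addrA subrK. Qed.

Definition eij i j a : gl A l := \matrix_(k, m) (if (k == i) && (m == j) then a else 0).

Lemma eijE i j a k m : eij i j a k m = if (k == i) && (m == j) then a else 0.
Proof. by rewrite mxE. Qed.

Lemma mul_eij i j a x k m : (eij i j a * x) k m = if k == i then a * x j m else 0.
Proof.
rewrite gl_mulE (bigD1 j) //= big1 ?addr0 => [|p /negbTE pj].
  by rewrite eijE eqxx andbT; case: eqP; rewrite ?mul0r.
by rewrite eijE pj andbF mul0r.
Qed.

Lemma eij_mul i j a x k m : (x * eij i j a) k m = if m == j then x k i * a else 0.
Proof.
rewrite gl_mulE (bigD1 i) //= big1 ?addr0 => [|p /negbTE pi].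
  by rewrite eijE eqxx /=; case: eqP; rewrite ?mulr0.
by rewrite eijE pi mulr0.
Qed.

Lemma eijM i j a k m b : eij i j a * eij k m b = if j == k then eij i m (a * b) else 0.
Proof.
apply/matrixP=> p q; rewrite mul_eij eijE; case: (eqVneq j k) => _ /=.
  by rewrite eijE; case: (p == i) => //=; case: (q == m); rewrite ?mulr0.
by rewrite mxE mulr0; case: ifP.
Qed.

Lemma eij_lin i j c a b : eij i j (c *: a + b) = c *: eij i j a + eij i j b.
Proof.
by apply/matrixP=> p q; rewrite [RHS]mxE gl_scaleE !eijE; case: ifP; rewrite ?scaler0 ?addr0.
Qed.

Lemma eij0 i j : eij i j 0 = 0.
Proof. by apply/matrixP=> p q; rewrite eijE mxE; case: ifP. Qed.

Lemma eijD i j a b : eij i j (a + b) = eij i j a + eij i j b.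
Proof. by have := eij_lin i j 1 a b; rewrite !scale1r. Qed.

Lemma eijZ i j c a : eij i j (c *: a) = c *: eij i j a.
Proof. by have := eij_lin i j c a 0; rewrite eij0 !addr0. Qed.

Lemma eij_inj i j : injective (eij i j).
Proof. by move=> a b /matrixP/(_ i j); rewrite !eijE !eqxx. Qed.

Definition scalar_diag (s : 'I_l -> K) : gl A l :=
  \matrix_(i, j) (if i == j then (s i)%:A else 0).

Lemma lie_scalar_diag s x i j : lie (scalar_diag s) x i j = (s i - s j) *: x i j.
Proof.
rewrite gl_lieE !mxE (bigD1 i) //= [X in _ - X](bigD1 j) //= !big1 => [|k kj|k ki].
- by rewrite !addr0 !mxE !eqxx -scalerAl mul1r -scalerAr mulr1 scalerBl.
- by rewrite mxE (negbTE kj) mulr0.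
- by rewrite mxE eq_sym (negbTE ki) mul0r.
Qed.

Lemma eij_derived i j a : i != j -> eij i j a \in in_derived (L := gl A l).
Proof.
move=> ij; have -> : eij i j a = lie (eij i i 1) (eij i j a).
  by rewrite gl_lieE !eijM eqxx eq_sym (negbTE ij) subr0 mul1r.
exact: lie_in_derived.
Qed.

Lemma eigen_derived h x c : c != 0 -> lie h x = c *: x -> x \in in_derived (L := gl A l).
Proof.
move=> c0 hx; have -> : x = c^-1 *: lie h x by rewrite hx scalerA mulVf ?scale1r.
by apply: rpredZ; exact: lie_in_derived.
Qed.

Lemma lie_pow h x c n : lie h x = c *: x -> lie h (x ^+ n) = (c *+ n) *: x ^+ n.
Proof.
move=> hx; elim: n => [|n IHn].
  by rewrite expr0 mulr0n scale0r gl_lieE mulr1 mul1r subrr.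
by rewrite exprS lie_mul hx IHn -gl_scaleAl -gl_scaleAr -scalerDl mulrS.
Qed.

End GlAlgebra.

Section ScalarDiagonal.
Variables (K : fieldType) (A : algType K) (l : nat).

Lemma scalar_diag_sum (s : 'I_l -> K) :
  scalar_diag A s = \sum_i s i *: eij i i (1 : A).
Proof.
apply/matrixP=> p q; rewrite mxE summxE (bigD1 p) //= big1 ?addr0 => [|i /negbTE ip].
  by rewrite gl_scaleE eijE eqxx /= eq_sym; case: eqP => // _; rewrite scaler0.
by rewrite gl_scaleE eijE eq_sym ip scaler0.
Qed.

End ScalarDiagonal.

Lemma scalar_diag_derived (K : fieldType) (A : algType K) (l : nat) (s : 'I_l -> K) :
  \sum_i s i = 0 -> scalar_diag A s \in in_derived (L := gl A l).
Proof.
case: l s => [|n] s s0.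
  by rewrite scalar_diag_sum big_ord0; exact: rpred0.
(* Each bracket is the difference of the diagonal units at [i] and at 0; the contributions at 0
   cancel because the [s i] add up to zero. *)
have -> : scalar_diag A s = \sum_i s i *: lie (eij i ord0 (1 : A)) (eij ord0 i 1).
  transitivity (\sum_i (s i *: eij i i (1 : A) - s i *: eij ord0 ord0 1)).
    by rewrite sumrB -scaler_suml s0 scale0r subr0 scalar_diag_sum.
  by apply: eq_bigr => i _; rewrite gl_lieE !eijM !eqxx !mulr1 scalerBr.
by apply: rpred_sum => i _; apply: rpredZ; exact: lie_in_derived.
Qed.

(** * The principal grading *)

Lemma pchar0_natr_inj (K : fieldType) : [pchar K] =i pred0 ->
  injective (fun m : nat => m%:R : K).
Proof.
move=> /pcharf0P K0 m p; wlog mp : m p / (m <= p)%N => [H e|/= e].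
  by case/orP: (leq_total m p) => le; [exact: H|apply/esym/H].
apply/eqP; rewrite eqn_leq mp -subn_eq0 -K0 natrB // e subrr.
by rewrite eqxx.
Qed.

(** The map lives on all of [gl] and is constrained on the derived algebra only, so that associative
    products of images can be formed without coercions from a subtype. *)
Definition sl_morphism (K : fieldType) (A' A : algType K) (l' l : nat)
    (F : gl A' l' -> gl A l) : Prop :=
  [/\ forall x, x \in in_derived (L := gl A' l') -> F x \in in_derived (L := gl A l),
      forall c x y, x \in in_derived (L := gl A' l') ->
        y \in in_derived (L := gl A' l') -> F (c *: x + y) = c *: F x + F y
    & forall x y, x \in in_derived (L := gl A' l') ->
        y \in in_derived (L := gl A' l') -> F (lie x y) = lie (F x) (F y)].

Definition sl_inverse (K : fieldType) (A' A : algType K) (l' l : nat)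
    (F : gl A' l' -> gl A l) (G : gl A l -> gl A' l') : Prop :=
  [/\ sl_morphism F, sl_morphism G,
      forall x, x \in in_derived (L := gl A' l') -> G (F x) = x
    & forall y, y \in in_derived (L := gl A l) -> F (G y) = y].

Lemma sl_inverse_sym (K : fieldType) (A' A : algType K) (l' l : nat)
    (F : gl A' l' -> gl A l) (G : gl A l -> gl A' l') :
  sl_inverse F G -> sl_inverse G F.
Proof. by case. Qed.

Section SlMorphism.
Variables (K : fieldType) (A' A : algType K) (l' l : nat) (F : gl A' l' -> gl A l).
Hypothesis Fm : sl_morphism F.
Local Notation S' := (in_derived (L := gl A' l')).

Lemma slm_in x : x \in S' -> F x \in in_derived (L := gl A l).
Proof. by case: Fm => + _ _; exact. Qed.

Lemma slm_lie x y : x \in S' -> y \in S' -> F (lie x y) = lie (F x) (F y).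
Proof. by case: Fm => _ _; exact. Qed.

Lemma slm_lin c x y : x \in S' -> y \in S' -> F (c *: x + y) = c *: F x + F y.
Proof. by case: Fm => _ + _; exact. Qed.

Lemma slm0 : F 0 = 0.
Proof.
have S0 : (0 : gl A' l') \in S' by exact: rpred0.
by have := slm_lin (-1) S0 S0; rewrite scaler0 addr0 scaleN1r addNr.
Qed.

Lemma slmD x y : x \in S' -> y \in S' -> F (x + y) = F x + F y.
Proof. by move=> Sx Sy; have := slm_lin 1 Sx Sy; rewrite !scale1r. Qed.

Lemma slmZ c x : x \in S' -> F (c *: x) = c *: F x.
Proof.
move=> Sx; have S0 : (0 : gl A' l') \in S' by exact: rpred0.
by have := slm_lin c Sx S0; rewrite slm0 !addr0.
Qed.

Lemma slmN x : x \in S' -> F (- x) = - F x.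
Proof. by move=> Sx; rewrite -scaleN1r slmZ // scaleN1r. Qed.

Lemma slm_iter_lie m x y : x \in S' -> y \in S' ->
  F (iter m (lie x) y) = iter m (lie (F x)) (F y) /\ iter m (lie x) y \in S'.
Proof.
move=> Sx Sy; elim: m => [//|m [IHm Sm]] /=.
by rewrite slm_lie // IHm; split=> //; exact: lie_in_derived.
Qed.

End SlMorphism.

Section PrincipalGrading.
Variables (K : fieldType) (A' A : algType K) (r l : nat).
Variables (F : gl A' r.+1 -> gl A l) (G : gl A l -> gl A' r.+1).
Hypotheses (K0 : [pchar K] =i pred0) (FG : sl_inverse F G).
Local Notation S' := (in_derived (L := gl A' r.+1)).

Let Fm : sl_morphism F. Proof. by case: FG. Qed.
Let Gm : sl_morphism G. Proof. by case: FG. Qed.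
Let natr0 (m : nat) : (m%:R == 0 :> K) = (m == 0)%N.
Proof. by move/pcharf0P: K0. Qed.

(* The factor [r.+1] keeps the entries of the principal diagonal matrix integral
   while making its trace zero. *)
Definition principal_weight (i : 'I_r.+1) : K :=
  (\sum_(j < r.+1) val j)%:R - (r.+1 * i)%:R.
Local Notation w := principal_weight.
Local Notation H' := (scalar_diag A' w).

Lemma principal_in_derived : H' \in S'.
Proof.
apply: scalar_diag_derived; rewrite sumrB sumr_const card_ord -natr_sum.
by rewrite -big_distrr /= natrM mulr_natl subrr.
Qed.

Lemma principal_diff (i j : 'I_r.+1) (d : nat) : (j = i + d :> nat)%N -> w i - w j = (r.+1 * d)%:R.
Proof.
move=> jE; rewrite /principal_weight jE opprB addrC addrA subrK mulnDr natrD.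
by rewrite addrC addKr.
Qed.

Lemma principal_diff_neq (i j : 'I_r.+1) (d : nat) : (r < d)%N -> w i - w j != (r.+1 * d)%:R.
Proof.
move=> rd; rewrite /principal_weight opprB addrC addrA subrK subr_eq -natrD; apply/negP.
move/eqP/(pchar0_natr_inj K0); rewrite -mulnDr => /eqP; rewrite eqn_mul2l /= => /eqP jd.
by have := ltn_ord j; rewrite jd ltnNge (leq_trans rd) ?leq_addr.
Qed.

(** A vector of non-zero weight is a multiple of a bracket, so [G] may be applied to it; the result
    has the same weight under [H'], whose weights on matrices are [r.+1] times differences of
    indices below [r.+1]. This makes associative products of images vanish although [F] respects
    brackets only. *)
Lemma principal_weight_gap (y : gl A l) (d : nat) : (r < d)%N ->
  lie (F H') y = (r.+1 * d)%:R *: y -> y = 0.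
Proof.
move=> rd Hy; have c0 : (r.+1 * d)%:R != 0 :> K.
  by rewrite natr0 muln_eq0 /=; case: d rd {Hy}.
have Sy := eigen_derived c0 Hy.
have [_ _ GF FGy] := FG.
have HGy : lie H' (G y) = (r.+1 * d)%:R *: G y.
  rewrite -(slmZ Gm) // -Hy (slm_lie Gm) ?GF ?principal_in_derived //.
  exact: slm_in principal_in_derived.
suff Gy0 : G y = 0 by rewrite -(FGy y Sy) Gy0 (slm0 Fm).
apply/matrixP=> i j; rewrite [RHS]mxE; move/matrixP/(_ i j): HGy.
rewrite lie_scalar_diag gl_scaleE => /eqP; rewrite -subr_eq0 -scalerBl scaler_eq0.
by rewrite subr_eq0 (negbTE (principal_diff_neq _ _ rd)) => /eqP.
Qed.

Definition principal_nilpotent : gl A' r.+1 :=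
  \matrix_(i, j) (if (j == i.+1 :> nat)%N then 1 else 0).
Local Notation e' := principal_nilpotent.

Lemma principal_nilpotentX k (i j : 'I_r.+1) :
  (e' ^+ k) i j = if (j == i + k :> nat)%N then 1 else 0.
Proof.
elim: k i j => [|k IHk] i j.
  by rewrite expr0 addn0 mxE eq_sym -val_eqE /=; case: eqP.
rewrite exprS gl_mulE; case: (boolP (i.+1 < r.+1)%N) => ir.
  rewrite (bigD1 (Ordinal ir)) //= big1 ?addr0 => [|m mi].
    by rewrite mxE eqxx mul1r IHk /= addnS.
  rewrite mxE; case: eqP => [mE|_]; last by rewrite mul0r.
  by case/eqP: mi; apply: val_inj.
rewrite big1 => [|m _]; last first.
  rewrite mxE; case: eqP => [mE|_]; last by rewrite mul0r.
  by case/negP: ir; rewrite -mE.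
case: eqP => // jE; case/negP: ir; apply: leq_ltn_trans (ltn_ord j).
by rewrite jE addnS ltnS leq_addr.
Qed.

Lemma lie_principal_nilpotent : lie H' e' = (r.+1 * 1)%:R *: e'.
Proof.
apply/matrixP=> i j; rewrite lie_scalar_diag gl_scaleE mxE.
case: eqP => ij; last by rewrite !scaler0.
by rewrite (@principal_diff i j 1) // addn1.
Qed.

Lemma principal_nilpotent_derived : e' \in S'.
Proof.
by apply: eigen_derived lie_principal_nilpotent; rewrite natr0 muln1.
Qed.

Local Notation N := ((F e') ^+ r).

(** Since [ad] acts by derivations of the associative product, this power has weight [r.+1] times
    that of [F e'], beyond the gap. *)
Lemma image_nilpotent : (F e') ^+ r.+1 = 0.
Proof.
apply: (@principal_weight_gap _ r.+1) => //.
have -> : lie (F H') (F e' ^+ r.+1) = ((r.+1 * 1)%:R *+ r.+1) *: F e' ^+ r.+1.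
  apply: lie_pow; rewrite -(slm_lie Fm) ?lie_principal_nilpotent.
  - by rewrite (slmZ Fm) // principal_nilpotent_derived.
  - exact: principal_in_derived.
  - exact: principal_nilpotent_derived.
by rewrite muln1 -mulrnA.
Qed.

Hypothesis r0 : (0 < r)%N.
Local Notation E b := (F (eij ord0 ord_max b)).
Local Notation Y b := (F (eij ord_max ord0 b)).

Let max0 : (ord_max : 'I_r.+1) != ord0.
Proof. by rewrite -val_eqE /= -lt0n. Qed.

Lemma corner_derived (b : A') : eij ord0 ord_max b \in S'.
Proof. by apply: eij_derived; rewrite eq_sym. Qed.

Lemma opposite_corner_derived (b : A') : eij ord_max ord0 b \in S'.
Proof. exact: eij_derived. Qed.

Lemma principal_nilpotent_top : e' ^+ r = eij ord0 ord_max 1.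
Proof.
apply/matrixP=> i j; rewrite principal_nilpotentX eijE; congr (if _ then _ else _).
apply/eqP/andP=> [jE|[/eqP -> /eqP -> //]].
have i0 : i = ord0.
  apply: val_inj; apply/eqP; rewrite /= -leqn0 -(leq_add2r r) -jE add0n.
  by rewrite -ltnS ltn_ord.
by split; apply/eqP => //; apply: val_inj; rewrite /= jE i0.
Qed.

(** Apply [F] to [(ad e')^(2r)] of the opposite corner. On both sides [iter_commutator_middle]
    leaves the middle term only, with the same factor, a sign times ['C(r + r, r)], which is
    invertible in characteristic zero. *)
Lemma image_corner b : N * Y b * N = E b.
Proof.
have e'0 : e' ^+ r.+1 = 0.
  apply/matrixP=> i j; rewrite principal_nilpotentX mxE; case: eqP => // jE.
  by have := ltn_ord j; rewrite jE ltnNge leq_addl.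
have [E1 _] := slm_iter_lie Fm (r + r) principal_nilpotent_derived (opposite_corner_derived b).
move: E1; rewrite (eq_iter (gl_lieE (F e'))) (eq_iter (gl_lieE e')).
rewrite (iter_commutator_middle _ image_nilpotent) (iter_commutator_middle _ e'0).
rewrite principal_nilpotent_top eijM eqxx eijM eqxx mulr1 mul1r -!scaler_nat.
have C0 : ('C(r + r, r))%:R != 0 :> K by rewrite natr0 -lt0n bin_gt0 leq_addr.
have SE := corner_derived b.
rewrite -!(signr_odd _ r) !mulr_sign; case: odd.
  by rewrite (slmZ Fm) ?rpredN // (slmN Fm) // => /(scalerI C0)/eqP; rewrite eqr_opp => /eqP ->.
by rewrite (slmZ Fm) // => /(scalerI C0) ->.
Qed.

(** The product has twice the highest weight, which lies beyond the gap as [r > 0]. *)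
Lemma image_cornerM a b : E a * E b = 0.
Proof.
have wE c : lie (F H') (E c) = (r.+1 * r)%:R *: E c.
  rewrite -(slm_lie Fm) ?corner_derived ?principal_in_derived //.
  rewrite -(slmZ Fm) ?corner_derived //; congr F; apply/matrixP=> i j.
  rewrite lie_scalar_diag gl_scaleE eijE; case: ifP => [/andP[/eqP -> /eqP ->]|_].
    by rewrite (@principal_diff _ _ r).
  by rewrite !scaler0.
apply: (@principal_weight_gap _ (r + r)); first by rewrite -[X in (X < _)%N]addn0 ltn_add2l.
by rewrite lie_mul !wE -gl_scaleAl -gl_scaleAr -scalerDl -natrD -mulnDr.
Qed.

(** Expand the image of the double bracket of the corner of [a], the opposite corner of 1 and the
    corner of [b]: by [image_cornerM] the terms in which two corner images are adjacent vanish. *)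
Lemma image_corner_jordan a b :
  E a * Y 1 * E b + E b * Y 1 * E a = E (a * b + b * a).
Proof.
have <- : lie (lie (eij ord0 ord_max a : gl A' r.+1) (eij ord_max ord0 1)) (eij ord0 ord_max b)
    = eij ord0 ord_max (a * b + b * a).
  rewrite !gl_lieE !eijM !eqxx mulrBl mulrBr !eijM !eqxx (negbTE max0).
  by rewrite subr0 sub0r opprK !mulr1 mul1r eijD.
rewrite (slm_lie Fm) ?corner_derived ?lie_in_derived //.
rewrite (slm_lie Fm) ?corner_derived ?opposite_corner_derived // !gl_lieE.
rewrite mulrBl mulrBr -!mulrA image_cornerM mulr0 subr0.
by rewrite [E b * (E a * _)]mulrA image_cornerM mul0r sub0r opprK.
Qed.

End PrincipalGrading.

(** * Lines over the skew field of fractions *)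

Section ColumnModule.
Variables (K : fieldType) (Q : algType K) (n : nat) (X : 'rV[int]_n -> Q).
Hypothesis XB : torus_basis X.
Local Notation ord := (lex_translation_order n).
Local Notation lead := (leading_term XB (@lex_pos n)).

Let domain (y z : Q) : y != 0 -> z != 0 -> y * z != 0.
Proof. exact: (basis_domain XB ord). Qed.

Lemma mulmx_scalarE (l : nat) (v : 'cV[Q]_l) (c : Q) i : (v *m c%:M) i 0 = v i 0 * c.
Proof. by rewrite mxE big_ord1 mxE eqxx. Qed.

Lemma column_neq0 (l : nat) (v : 'cV[Q]_l) : v != 0 -> exists i, v i 0 != 0.
Proof.
move=> v0; apply/existsP; apply: contraNT v0 => /existsPn v0; apply/eqP/matrixP=> i j.
by rewrite mxE ord1; apply/eqP; have := v0 i; rewrite negbK.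
Qed.

Lemma column_scalar_eq0 (l : nat) (v : 'cV[Q]_l) (c : Q) :
  v != 0 -> v *m c%:M = 0 -> c = 0.
Proof.
move=> /column_neq0[i vi] /matrixP/(_ i 0); rewrite mulmx_scalarE [RHS]mxE => /eqP vc.
by apply/eqP; apply: contraTT vc => /(domain vi).
Qed.

Lemma columns_dependent (l : nat) (v : nat -> 'cV[Q]_l) :
  exists c : nat -> Q, (exists2 i, (i < l.+1)%N & c i != 0) /\
    \sum_(i < l.+1) v i *m (c i)%:M = 0.
Proof.
have [c c0 Ac] := rank_condition XB (\matrix_(k < l, i < l.+1) v i k 0).
exists (fun i => c (inord i) 0); split.
  by have [i ci] := column_neq0 c0; exists i => //; rewrite inord_val.
apply/matrixP=> k j; rewrite ord1 {j} summxE; move/matrixP/(_ k 0): Ac.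
rewrite [LHS]mxE => Ac; rewrite -[RHS]Ac; apply: eq_bigr => i _.
by rewrite mulmx_scalarE mxE inord_val.
Qed.

Section NilpotentChain.
Variables (l r : nat) (e : 'M[Q]_l) (w u : 'cV[Q]_l).
Hypotheses (e0 : e ^+ r.+1 = 0) (ewu : e ^+ r *m w = u) (u0 : u != 0).

Let eN m : (r < m)%N -> e ^+ m = 0.
Proof. by move=> rm; rewrite -(subnKC rm) exprD e0 mul0r. Qed.

(** Multiplying the relation by [e ^+ (r - i)] kills the terms above [i], those below vanish by
    induction, and the term [i] becomes [u] times [c i]. *)
Lemma nilpotent_chain_free (m : nat) (c : nat -> Q) : (m <= r.+1)%N ->
  \sum_(i < m) e ^+ i *m w *m (c i)%:M = 0 -> forall i, (i < m)%N -> c i = 0.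
Proof.
move=> mr sum0; elim/ltn_ind=> i IHi im.
have ir : (i <= r)%N by rewrite -ltnS (leq_trans im).
apply: (column_scalar_eq0 u0); have := congr1 (mulmx (e ^+ (r - i))) sum0.
rewrite mulmx0 mulmx_sumr (bigD1 (Ordinal im)) //= big1 ?addr0 => [|j ji].
  by rewrite !mulmxA -[_ *m e ^+ i]exprD subnK // ewu.
rewrite !mulmxA -[_ *m e ^+ j]exprD; case: (ltngtP j i) => ij.
- by rewrite (IHi j ij (ltn_trans ij im)) raddf0 mulmx0.
- by rewrite eN ?mul0mx // -{1}(subnK ir) ltn_add2l.
- by case/eqP: ji; apply: val_inj.
Qed.

Lemma nilpotent_chain_rank : (r < l)%N.
Proof.
rewrite ltnNge; apply/negP=> lr.
have [c [[i il /eqP ci] sum0]] := columns_dependent (fun i => e ^+ i *m w).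
by apply: ci; apply: nilpotent_chain_free il.
Qed.

(* [y] and [u] are proportional over the right skew field of fractions of [Q]. *)
Definition in_line (y : 'cV[Q]_l) : Prop :=
  exists q c : Q, q != 0 /\ y *m q%:M = u *m c%:M.

(** The [l + 1] columns [y], [w], [e w], ..., [e^r w] are dependent, and [y] occurs in the relation
    because the chain is free. Applying [e ^+ r] leaves only the terms of [y] and [w]. *)
Lemma nilpotent_top_line (y : 'cV[Q]_l) : l = r.+1 -> in_line (e ^+ r *m y).
Proof.
move=> lr; pose v i := if i is j.+1 then e ^+ j *m w else y.
have [c [[i il ci] sum0]] := columns_dependent v.
move: sum0; rewrite big_ord_recl /= => sum0.
have c0 : c 0%N != 0.
  apply: contraNneq ci => c0; apply/eqP; case: i il => // i il.
  apply: (@nilpotent_chain_free l (fun i => c i.+1)) => //; first by rewrite lr.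
  by move: sum0; rewrite c0 raddf0 mulmx0 add0r.
exists (c 0%N), (- c 1%N); split=> //; apply/eqP; rewrite raddfN mulmxN -addr_eq0; apply/eqP.
have := congr1 (mulmx (e ^+ r)) sum0; rewrite mulmx0 mulmxDr mulmx_sumr mulmxA.
have l0 : (0 < l)%N by rewrite lr.
rewrite (bigD1 (Ordinal l0)) //= big1 ?addr0 => [|j j0].
  by rewrite expr0 mul1mx mulmxA ewu.
rewrite /bump /= add1n !mulmxA -[_ *m e ^+ _]exprD eN ?mul0mx // -[X in (X < _)%N]addn0.
by rewrite ltn_add2l lt0n -(inj_eq val_inj) in j0 *.
Qed.

End NilpotentChain.

Section LineAction.
Variables (l : nat) (u : 'cV[Q]_l) (i : 'I_l).
Hypothesis ui : u i 0 != 0.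
Local Notation line := (in_line u).

Lemma line_self : line u.
Proof. by exists 1, 1; rewrite oner_neq0. Qed.

(** Vectors of the line are proportional to [u], so the single entry [i] detects whether they vanish
    and may be used to read leading terms. *)
Lemma line_entry y : line y -> y != 0 -> y i 0 != 0.
Proof.
move=> [q [c [q0 yq]]] /column_neq0[j yj].
have entry k : y k 0 * q = u k 0 * c by rewrite -!mulmx_scalarE yq.
have c0 : c != 0.
  by apply: contraNneq (domain yj q0) => c0; rewrite entry c0 mulr0.
by apply: contraNneq (domain ui c0) => yi; rewrite -entry yi mul0r.
Qed.

(* All vectors of the line being proportional over the skew field of fractions,
   an endomorphism multiplies their leading terms by a fixed monomial [L]. *)
Definition line_action (A : 'M[Q]_l) (L : Q) : Prop :=
  forall y m, line y -> lead (y i 0) m -> lead ((A *m y) i 0) (L * m).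

Lemma monomial_inverse (a : 'rV[int]_n) (c : K) : c != 0 ->
  exists d, d != 0 /\ (d *: X (- a)) * (c *: X a) = 1.
Proof.
move=> c0; have [s s0 XX] := tbM XB (- a) a.
exists (s^-1 * c^-1); split; first by rewrite mulf_neq0 ?invr_eq0.
rewrite -scalerAl -scalerAr XX addNr (tb0 XB) !scalerA.
by rewrite mulfVK // mulVf // scale1r.
Qed.

Lemma lead_neq0 z m : lead z m -> z != 0.
Proof. by case=> a [c [/(leading_neq0 ord) + _]]. Qed.

Lemma lead_cancel z m p p' : lead z m -> p * m = p' * m -> p = p'.
Proof.
case=> a [c [ld ->]] pm; have [d [_ dc]] := monomial_inverse (- a) (oner_neq0 K).
apply/eqP; rewrite -subr_eq0; apply: contraTT isT => pp.
have c0 : c *: X a != 0 by rewrite scaler_eq0 (negbTE (tb_neq0 XB a)) orbF; case: ld.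
by have := domain pp c0; rewrite mulrBl pm subrr eqxx.
Qed.

(** The monomial is the leading term of [(A u)_i] times the inverse of that of [u_i]. If [y q = u e]
    then also [A y q = A u e]; comparing leading terms of the [i]-th entries and cancelling those of
    [q] and [e] shows that it serves every [y]. *)
Lemma line_action_exists (A : 'M[Q]_l) : line (A *m u) -> A *m u != 0 ->
  exists a c, c != 0 /\ line_action A (c *: X a).
Proof.
move=> Au Au0; have v0 := line_entry Au Au0.
have [mu lu] := leading_term_exists XB ord ui.
have [mv lv] := leading_term_exists XB ord v0.
have [a [c [lua muE]]] := lu; have [b [d [lvb mvE]]] := lv.
have c0 : c != 0 by case: lua.
have d0 : d != 0 by case: lvb.
have [d' [d'0 inv]] := monomial_inverse a c0.
have [s s0 XX] := tbM XB b (- a).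
exists (b - a), (d * d' * s); split; first by rewrite !mulf_neq0.
have -> : (d * d' * s) *: X (b - a) = mv * (d' *: X (- a)).
  by rewrite mvE -scalerAl -scalerAr XX !scalerA.
move=> y m [q [e [q0 yq]]] lm; have y0 := lead_neq0 lm.
have entry : y i 0 * q = u i 0 * e by rewrite -!mulmx_scalarE yq.
have entryA : (A *m y) i 0 * q = (A *m u) i 0 * e.
  by rewrite -!mulmx_scalarE -!mulmxA yq.
have e0 : e != 0 by apply: contraNneq (domain y0 q0) => e0; rewrite entry e0 mulr0.
have [mq lq] := leading_term_exists XB ord q0.
have [me le] := leading_term_exists XB ord e0.
have E1 : m * mq = mu * me.
  apply: (leading_term_uniq ord) (leading_termM ord lm lq) _.
  by rewrite entry; exact: (leading_termM ord).
have lAq : lead ((A *m y) i 0 * q) (mv * me).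
  by rewrite entryA; exact: (leading_termM ord).
have Ay0 : (A *m y) i 0 != 0.
  by apply: contraNneq (lead_neq0 lAq) => ->; rewrite mul0r.
have [m' lm'] := leading_term_exists XB ord Ay0.
suff <- : m' = mv * (d' *: X (- a)) * m by [].
apply: (lead_cancel lq); rewrite -[RHS]mulrA E1 muE.
rewrite -[RHS]mulrA [d' *: _ * _]mulrA inv mul1r.
apply: (leading_term_uniq ord) _ lAq.
exact: (leading_termM ord).
Qed.

Lemma line_actionM (A B : 'M[Q]_l) L L' : (forall y, line y -> line (B *m y)) ->
  line_action A L -> line_action B L' -> line_action (A *m B) (L * L').
Proof.
move=> Bl AL BL y m ly lm; rewrite -mulmxA -mulrA.
by apply: AL; [exact: Bl|exact: BL].
Qed.

Lemma line_action_uniq A L L' : line_action A L -> line_action A L' -> L = L'.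
Proof.
move=> AL AL'; have [mu lu] := leading_term_exists XB ord ui.
apply: (lead_cancel lu).
exact: (leading_term_uniq ord) (AL _ _ line_self lu) (AL' _ _ line_self lu).
Qed.

(** All three operators shift exponents by the same [a], so the relation is read off from the
    coefficients at [a + b], where [b] is the leading exponent of [u i 0]; the common factors
    cancel. *)
Lemma line_action_sum (A1 A2 A3 : 'M[Q]_l) (a : 'rV[int]_n) (c1 c2 c3 : K) (k : K) :
  (forall y : 'cV[Q]_l, (A1 *m y) i 0 + (A2 *m y) i 0 = k *: (A3 *m y) i 0) ->
  line_action A1 (c1 *: X a) -> line_action A2 (c2 *: X a) ->
  line_action A3 (c3 *: X a) -> c1 + c2 = k * c3.
Proof.
move=> sumA A1L A2L A3L; have [mu lu] := leading_term_exists XB ord ui.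
have [b [c [lub muE]]] := lu; have c0 : c != 0 by case: lub.
have [s s0 XX] := tbM XB a b.
have coefA A d : line_action A (d *: X a) -> tcoef XB ((A *m u) i 0) (a + b) = d * c * s.
  move=> /(_ _ _ line_self lu)[a' [d' [ldA]]].
  have d'0 : d' != 0 by case: ldA.
  have ld := leading_coef ord ldA.
  rewrite muE -scalerAl -scalerAr XX !scalerA => E.
  have := congr1 (fun y => tcoef XB y (a + b)) E.
  rewrite !tcoefZ !tcoefX eqxx mulr1; case: eqP => [-> ->|_]; first by rewrite mulr1 ld.
  rewrite mulr0 => ds0; have d0 : d = 0.
    by apply/eqP; move/eqP: ds0; rewrite !mulf_eq0 (negbTE c0) (negbTE s0) !orbF.
  move: E; rewrite d0 !mul0r scale0r => /esym/eqP; rewrite scaler_eq0.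
  by rewrite (negbTE (tb_neq0 XB a')) (negbTE d'0).
have := congr1 (fun y => tcoef XB y (a + b)) (sumA u).
rewrite tcoefD tcoefZ (coefA _ _ A1L) (coefA _ _ A2L) (coefA _ _ A3L) -!mulrDl !mulrA.
by move/(mulIf s0)/(mulIf c0).
Qed.

End LineAction.

End ColumnModule.

(** * The exponent map *)

Lemma jordan_square (K : fieldType) (A : algType K) (l : nat) (B : algType K)
    (h : B -> gl A l) : 2%:R != 0 :> K -> (forall c a, h (c *: a) = c *: h a) ->
  (forall a b, h a * h b + h b * h a = h (a * b + b * a)) ->
  forall a, h (a * a) = h a * h a.
Proof.
move=> two0 hZ hJ a; apply: (scalerI two0).
by rewrite -hZ !scaler_nat !mulr2n hJ.
Qed.

Lemma addr_cancel_mid (V : zmodType) (p q s : V) : p + q + (q + s) - (p + s) = q + q.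
Proof. by rewrite [p + q]addrC addrACA addrK. Qed.

(** Twice [a b a] equals [{a, {a, b}} - {a^2, b}], where [{x, y} = x y + y x]. *)
Lemma jordan_triple (K : fieldType) (A : algType K) (l : nat) (B : algType K)
    (h : B -> gl A l) : 2%:R != 0 :> K -> (forall c a, h (c *: a) = c *: h a) ->
  (forall a b, h (a + b) = h a + h b) ->
  (forall a b, h a * h b + h b * h a = h (a * b + b * a)) ->
  forall a b, h (a * b * a) = h a * h b * h a.
Proof.
move=> two0 hZ hD hJ a b; apply: (scalerI two0); rewrite -hZ !scaler_nat !mulr2n.
have -> : a * b * a + a * b * a =
    (a * (a * b + b * a) + (a * b + b * a) * a) - (a * a * b + b * (a * a)).
  by rewrite mulrDr mulrDl !mulrA addr_cancel_mid.
have hN x : h (- x) = - h x by rewrite -scaleN1r hZ scaleN1r.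
rewrite hD hN -!hJ (jordan_square two0 hZ hJ).
by rewrite mulrDr mulrDl !mulrA addr_cancel_mid.
Qed.

Section ExponentMap.
Variables (K : fieldType) (Q' Q : algType K) (r l : nat).
Variables (F : gl Q' r.+1 -> gl Q l) (G : gl Q l -> gl Q' r.+1).
Hypotheses (K0 : [pchar K] =i pred0) (FG : sl_inverse F G) (r0 : (0 < r)%N).
Variables (n : nat) (X : 'rV[int]_n -> Q).
Hypothesis XB : torus_basis X.

Let Fm : sl_morphism F. Proof. by case: FG. Qed.
Let two0 : 2%:R != 0 :> K. Proof. by move/pcharf0P: K0 => ->. Qed.

Local Notation E b := (F (eij ord0 ord_max b)).
Local Notation Y b := (F (eij ord_max ord0 b)).
Local Notation e := (F (principal_nilpotent Q' r) : 'M[Q]_l).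

(** Corner images multiply to zero, but followed by [Y 1] they obey the Jordan identity
    [corner_action_jordan]. *)
Definition corner_action (b : Q') : gl Q l := E b * Y 1.
Local Notation A := corner_action.

Lemma corner_actionZ c a : A (c *: a) = c *: A a.
Proof. by rewrite /A eijZ (slmZ Fm) ?corner_derived // gl_scaleAl. Qed.

Lemma corner_actionD a b : A (a + b) = A a + A b.
Proof. by rewrite /A eijD (slmD Fm) ?corner_derived // mulrDl. Qed.

Lemma corner_action_jordan a b : A a * A b + A b * A a = A (a * b + b * a).
Proof. by rewrite /A -(image_corner_jordan K0 FG r0) mulrDl !mulrA. Qed.

Lemma corner_image_neq0 b : b != 0 -> E b != 0.
Proof.
apply: contraNneq => Eb; have [_ _ GF _] := FG.
have Gm : sl_morphism G by case: FG.
apply/eqP/(@eij_inj _ _ r.+1 ord0 ord_max); rewrite eij0.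
by rewrite -(GF _ (corner_derived r0 b)) Eb (slm0 Gm).
Qed.

Lemma corner_sandwich : E 1 * Y 1 * E 1 = E 1.
Proof.
have := image_corner_jordan K0 FG r0 1 1.
rewrite mulr1 eijD (slmD Fm) ?corner_derived // -!mulr2n -!scaler_nat.
exact: scalerI.
Qed.

(** Take for [u] a non-zero column of [E 1]: by [image_corner] it is in the image of [e ^+ r], and
    by [corner_sandwich] it is fixed by [A 1]. *)
Lemma top_vector : exists w u : 'cV[Q]_l,
  [/\ e ^+ r *m w = u, u != 0 & (A 1 : 'M[Q]_l) *m u = u].
Proof.
pose E1 : 'M[Q]_l := E 1.
have [j Ej] : exists j, col j E1 != 0.
  apply/existsP; apply: contraNT (corner_image_neq0 (oner_neq0 Q')) => /existsPn E0.
  apply/eqP/matrixP=> i j; rewrite [RHS]mxE; have := E0 j; rewrite negbK => /eqP.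
  by move/matrixP/(_ i 0); rewrite !mxE.
exists ((Y 1 : 'M[Q]_l) *m e ^+ r *m delta_mx j 0), (col j E1); split=> //.
- by rewrite colE !mulmxA; congr (_ *m _); exact: (image_corner K0 FG r0).
- by rewrite colE mulmxA; congr (_ *m _); exact: corner_sandwich.
Qed.

Lemma sl_rank_le : (r < l)%N.
Proof.
have [w [u [ewu u0 _]]] := top_vector.
exact: (nilpotent_chain_rank XB (image_nilpotent K0 FG) ewu u0).
Qed.

End ExponentMap.

Lemma monomial_inj (K : fieldType) (Q : algType K) (G : zmodType) (X : G -> Q)
    (a b : G) (c d : K) : torus_basis X -> c != 0 -> c *: X a = d *: X b -> a = b.
Proof.
move=> XB c0 /(congr1 (fun y => tcoef XB y a)); rewrite !tcoefZ !tcoefX eqxx mulr1.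
by case: eqP => // _ /eqP; rewrite mulr0 (negbTE c0).
Qed.

Lemma eq_or_inverse (K : fieldType) (s b : K) : s != 0 -> b != 0 ->
  s + s^-1 = b + b^-1 -> s = b \/ s = b^-1.
Proof.
move=> s0 b0 sb; have : (s - b) * (s * b - 1) = 0.
  have -> : (s - b) * (s * b - 1) = s * b * (s + s^-1 - (b + b^-1)).
    by field; rewrite s0 b0.
  by rewrite sb subrr mulr0.
move/eqP; rewrite mulf_eq0 !subr_eq0 => /orP[/eqP ->|/eqP sb1]; [by left|right].
by apply: (mulIf b0); rewrite sb1 mulVf.
Qed.

Section ExponentMap.
Variables (K : fieldType) (Q' Q : algType K) (r : nat).
Variables (F : gl Q' r.+1 -> gl Q r.+1) (G : gl Q r.+1 -> gl Q' r.+1).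
Hypotheses (K0 : [pchar K] =i pred0) (FG : sl_inverse F G) (r0 : (0 < r)%N).
Variables (n n' : nat) (X : 'rV[int]_n -> Q) (X' : 'rV[int]_n' -> Q').
Hypotheses (XB : torus_basis X) (XB' : torus_basis X').
Local Notation ord := (lex_translation_order n).
Local Notation beta := (commutation XB).
Local Notation beta' := (commutation XB').
Local Notation A b := (corner_action F b : 'M[Q]_r.+1).
Local Notation E b := (F (eij ord0 ord_max b)).

Let two0 : 2%:R != 0 :> K. Proof. by move/pcharf0P: K0 => ->. Qed.
Let Fm : sl_morphism F. Proof. by case: FG. Qed.
Let AZ := corner_actionZ FG r0.
Let AJ := corner_action_jordan K0 FG r0.
Let AT := jordan_triple two0 AZ (corner_actionD FG r0) AJ.

Lemma gl_scale_mulmx (k : K) (M : gl Q r.+1) (y : 'cV[Q]_r.+1) i :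
  (((k *: M : gl Q r.+1) : 'M[Q]_r.+1) *m y) i 0 = k *: ((M : 'M[Q]_r.+1) *m y) i 0.
Proof.
rewrite !mxE scaler_sumr; apply: eq_bigr => j _; rewrite gl_scaleE.
by rewrite scalerAl.
Qed.

(** [phi a] is the exponent of the monomial by which [A (X' a)] acts on leading terms along the line
    of [u]. The last clause ties [phi] to multiplication by scalars, which is how central monomials
    are followed later. *)
Lemma exponent_map : exists phi : 'rV[int]_n' -> 'rV[int]_n,
  [/\ forall a b, phi (a + b) = phi a + phi b,
      forall a b, beta (phi a) (phi b) = beta' a b \/ beta (phi a) (phi b) = (beta' a b)^-1
    & forall a (z : Q), z != 0 -> (forall i j, E (X' a) i j = z * E 1 i j) ->
        exists c, leading XB (@lex_pos n) z (phi a) c].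
Proof.
have [w [u [ewu u0 A1u]]] := top_vector K0 FG r0.
have [i ui] := column_neq0 u0.
pose LA M L := line_action XB u i M L.
have lineA b y : in_line u (A b *m y).
  rewrite /corner_action -(image_corner K0 FG r0) -!mulmxA.
  exact: (nilpotent_top_line XB (image_nilpotent K0 FG) ewu u0).
(* The triple product [X' a * X' (- (a + a)) * X' a] is a non-zero scalar, so [A (X' a)] is a factor
   of a non-zero multiple of [A 1], which fixes [u]. *)
have Au a : A (X' a) *m u != 0.
  have [s s0 XX] := tbM XB' a (- (a + a)); have [t t0 XX2] := tbM XB' (a - (a + a)) a.
  apply: contraNneq u0 => Aa0; have := AT (X' a) (X' (- (a + a))).
  rewrite XX -scalerAl XX2.
  have -> : a - (a + a) + a = 0 by rewrite opprD addrA subrr sub0r addNr.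
  rewrite (tb0 XB') scalerA AZ => /(congr1 (fun M : gl Q r.+1 => (M : 'M[Q]_r.+1) *m u)).
  rewrite -[(_ * _ * _) *m u]mulmxA Aa0 mulmx0 => st; apply/eqP/matrixP=> j k.
  rewrite ord1 [RHS]mxE; move/matrixP/(_ j 0): st.
  rewrite gl_scale_mulmx A1u [RHS]mxE => /eqP; rewrite scaler_eq0 mulf_eq0.
  by rewrite (negbTE s0) (negbTE t0) => /eqP.
have exL a : exists p, exists2 c, c != 0 & LA (A (X' a)) (c *: X p).
  by have [p [c [c0 L]]] := line_action_exists XB ui (lineA (X' a) u) (Au a); exists p, c.
have [phi phiP] := choice exL; exists phi.
have LM a b L L' : LA (A a) L -> LA (A b) L' -> LA (A a *m A b) (L * L').
  by apply: line_actionM => y _; exact: lineA.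
have LZ k a L : k != 0 -> LA (A (k *: a)) L -> LA (A a) (k^-1 *: L).
  move=> k0 La y m ly /(La y m ly).
  rewrite AZ gl_scale_mulmx => -[p [c [lpc E1]]].
  exists p, (k^-1 * c); split; last by rewrite -scalerA -E1 scalerAl.
  case: lpc => c0 low; split; first by rewrite mulf_neq0 ?invr_eq0.
  move=> q qn; apply: low; apply: contraNneq qn => q0.
  rewrite -[(_ *m _) i 0](scalerK k0) -scalerA -scalerBr tcoefZ q0 mulr0.
  by [].
(* A Jordan homomorphism need not respect [X' a * X' b], but it does respect the triple product,
   which is again a multiple of a monomial. *)
have phi_triple a b : phi (a + b + a) = phi a + phi b + phi a.
  have [c c0 La] := phiP a; have [d d0 Lb] := phiP b; have [c' c'0 Lt] := phiP (a + b + a).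
  have [s s0 XX] := tbM XB' a b; have [t t0 XX2] := tbM XB' (a + b) a.
  have E1 : A (X' a) *m A (X' b) *m A (X' a) = A ((s * t) *: X' (a + b + a)).
    by rewrite -[LHS]AT XX -scalerAl XX2 scalerA.
  have L1 : LA (A ((s * t) *: X' (a + b + a)))
      (c *: X (phi a) * (d *: X (phi b)) * (c *: X (phi a))).
    by rewrite -E1; apply: (line_actionM _ (LM _ _ _ _ La Lb) La) => y _; exact: lineA.
  have := line_action_uniq ui Lt (LZ _ _ _ (mulf_neq0 s0 t0) L1).
  have [s' s'0 XX'] := tbM XB (phi a) (phi b).
  have [t' t'0 XX2'] := tbM XB (phi a + phi b) (phi a).
  by rewrite -scalerAl -!scalerAr -!scalerAl XX' -scalerAl XX2' !scalerA => /(monomial_inj XB c'0).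
have phi0 : phi 0 = 0.
  have [c c0 L0] := phiP 0; have [mu lu] := leading_term_exists XB ord ui.
  have := L0 _ _ (line_self u) lu; rewrite (tb0 XB') A1u => lu'.
  have : (c *: X (phi 0)) * mu = 1 * mu by rewrite mul1r; exact: (leading_term_uniq ord lu' lu).
  by move/(lead_cancel lu); rewrite -(tb0 XB) -[X 0]scale1r => /(monomial_inj XB c0).
split.
(* Rewriting [a + 2 b + a] as twice [a + b] gives additivity up to a factor 2, which cancels in a
   lattice. *)
- have phi2 a : phi (a + a) = phi a + phi a.
    by have := phi_triple a 0; rewrite phi0 !addr0.
  move=> a b; have E1 : a + (b + b) + a = a + b + (a + b).
    by rewrite -!addrA [b + a]addrC.
  have := phi_triple a (b + b); rewrite E1 !phi2 -!addrA [phi b + phi a]addrC addrA.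
  move=> /rowP E2; apply/rowP=> j; have := E2 j.
  by rewrite !mxE -!mulr2n; apply: pmulrnI.
- move=> a b; have [c c0 La] := phiP a; have [d d0 Lb] := phiP b.
  pose t := commutation XB (phi a) (phi b); pose k := commutation XB' a b.
  have k0 : k != 0 := commutation_neq0 XB' a b.
  have t0 : t != 0 := commutation_neq0 XB (phi a) (phi b).
  apply: eq_or_inverse => //.
  (* In [Q'] the sum [a^2 b + b a^2] of monomials is [(k + k^-1) a b a]. The images act on the line
     with coefficients in the ratio [t], [t^-1] and 1, so [t + t^-1 = k + k^-1]. *)
  pose M1 := A (X' a) *m (A (X' a) *m A (X' b)); pose M2 := A (X' b) *m A (X' a) *m A (X' a).
  pose M3 := A (X' a) *m A (X' b) *m A (X' a).
  have LMr M L : LA M L -> LA (M *m A (X' a)) (L * (c *: X (phi a))).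
    by move=> LM'; apply: line_actionM LM' La => y _; exact: lineA.
  have L3 : LA M3 (c *: X (phi a) * (d *: X (phi b)) * (c *: X (phi a))) by apply/LMr/LM.
  have L2 : LA M2 (t^-1 *: (c *: X (phi a) * (d *: X (phi b)) * (c *: X (phi a)))).
    have := LMr _ _ (LM _ _ _ _ Lb La).
    have -> : d *: X (phi b) * (c *: X (phi a)) = t^-1 *: (c *: X (phi a) * (d *: X (phi b))).
      rewrite -!scalerAl -!scalerAr (commutationE XB (phi a)) -/t !scalerA; congr (_ *: _).
      by clearbody t; field.
    by rewrite -scalerAl.
  have L1 : LA M1 (t *: (c *: X (phi a) * (d *: X (phi b)) * (c *: X (phi a)))).
    have : LA M1 (c *: X (phi a) * (c *: X (phi a) * (d *: X (phi b)))).
      apply: line_actionM (LM _ _ _ _ La Lb) => // y _.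
      by rewrite -mulmxA; exact: lineA.
    have E0 : c *: X (phi a) * (d *: X (phi b)) = t *: (d *: X (phi b) * (c *: X (phi a))).
      by rewrite -!scalerAl -!scalerAr (commutationE XB (phi a)) -/t !scalerA; congr (_ *: _); ring.
    by rewrite [in X in X -> _]E0 -scalerAr mulrA.
  have [s s0 XX] := tbM XB (phi a) (phi b).
  have [s' s'0 XX'] := tbM XB (phi a + phi b) (phi a).
  have LE : c *: X (phi a) * (d *: X (phi b)) * (c *: X (phi a))
      = (c * d * s * c * s') *: X (phi a + phi b + phi a).
    by rewrite -scalerAl -!scalerAr -!scalerAl XX -scalerAl XX' !scalerA; congr (_ *: _); ring.
  rewrite LE ?scalerA in L1 L2 L3; set m := c * d * s * c * s' in L1 L2 L3.
  have m0 : m != 0 by rewrite !mulf_neq0.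
  pose Ca := corner_action F (X' a); pose Cb := corner_action F (X' b).
  have sum3 : Ca * (Ca * Cb) + Cb * Ca * Ca = (k + k^-1) *: (Ca * Cb * Ca).
    rewrite -(AT (X' a) (X' b)) -AZ -[Cb * Ca * Ca]mulrA mulrA.
    rewrite -(jordan_square two0 AZ AJ (X' a)) AJ; congr corner_action.
    rewrite scalerDl; congr (_ + _).
      by rewrite -mulrA [in LHS](commutationE XB' a b) -/k -scalerAr mulrA.
    by rewrite (commutationE XB' a b) -/k -scalerAl scalerA mulVf // scale1r mulrA.
  apply: (mulIf m0); rewrite [LHS]mulrDl.
  apply: (line_action_sum ui _ L1 L2 L3) => y.
  by rewrite -[RHS](gl_scale_mulmx _ (Ca * Cb * Ca)) -sum3 [in RHS]mulmxDl [RHS]mxE.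
(* Here [A (X' a)] is [z] times [A 1], so on [u], which [A 1] fixes, it acts as left multiplication
   by [z]. *)
- move=> a z z0 Ez; have [c c0 La] := phiP a.
  have [mu lu] := leading_term_exists XB ord ui; have [mz lz] := leading_term_exists XB ord z0.
  have := La _ _ (line_self u) lu.
  have -> : (A (X' a) *m u) i 0 = z * u i 0.
    rewrite -{2}A1u !mxE mulr_sumr; apply: eq_bigr => j _.
    rewrite mulrA; congr (_ * _); rewrite /corner_action !gl_mulE mulr_sumr.
    by apply: eq_bigr => k _; rewrite Ez mulrA.
  move=> lzu; have := leading_term_uniq ord lzu (leading_termM ord lz lu).
  move/(lead_cancel lu) => mzE; have [p [d [lpd mzE']]] := lz.
  by exists d; move: mzE; rewrite mzE' => /(monomial_inj XB c0) ->.
Qed.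

End ExponentMap.

(** * The centroid *)

Section ScalarMatrices.
Variables (K : fieldType) (A : algType K) (l : nat).
Local Notation S := (in_derived (L := gl A l)).

Lemma lieBl (x y z : gl A l) : lie (x - y) z = lie x z - lie y z.
Proof. by rewrite addrC -scaleN1r lie_linearl scaleN1r addrC. Qed.

Lemma lieBr (x y z : gl A l) : lie z (x - y) = lie z x - lie z y.
Proof. by rewrite addrC -scaleN1r lie_linearr scaleN1r addrC. Qed.

Definition gl_scalar (z : A) : gl A l := z%:M.

Lemma gl_scalarE z (x : gl A l) i j : (gl_scalar z * x) i j = z * x i j.
Proof. by rewrite -[_ * x]/(z%:M *m (x : 'M[A]_l)) mul_scalar_mx mxE. Qed.

Lemma gl_scalar_central z (x : gl A l) : (forall y, z * y = y * z) ->
  gl_scalar z * x = x * gl_scalar z.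
Proof.
move=> zc; apply/matrixP=> i j; rewrite gl_scalarE gl_mulE (bigD1 j) //= big1 ?addr0.
  by rewrite mxE eqxx mulr1n.
by move=> k /negbTE kj; rewrite mxE kj mulr0n mulr0.
Qed.

Lemma lie_gl_scalar z (x y : gl A l) : (forall y, z * y = y * z) ->
  lie (gl_scalar z * x) y = gl_scalar z * lie x y.
Proof.
by move=> zc; rewrite !gl_lieE mulrBr !mulrA -(gl_scalar_central y zc).
Qed.

Lemma lie_gl_scalarr z (x y : gl A l) : (forall y, z * y = y * z) ->
  lie x (gl_scalar z * y) = gl_scalar z * lie x y.
Proof.
by move=> zc; rewrite !gl_lieE mulrBr !mulrA -(gl_scalar_central x zc).
Qed.

Lemma gl_scalar_derived z (x : gl A l) : (forall y, z * y = y * z) -> x \in S ->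
  gl_scalar z * x \in S.
Proof.
move=> zc /asboolP[m [c [a [b ->]]]]; rewrite mulr_sumr.
apply: rpred_sum => i _; rewrite -gl_scaleAr -lie_gl_scalar //.
by apply: rpredZ; exact: lie_in_derived.
Qed.

(** Such a [w] is diagonal with [w i i * y = y * w j j] for [i != j]; taking [y = 1] makes all its
    entries equal, and then central. *)
Lemma commute_eij_central (w : gl A l) : (1 < l)%N ->
  (forall i j y, i != j -> lie w (eij i j y) = 0) -> forall x, lie w x = 0.
Proof.
move=> l1 wE.
have other i : exists j : 'I_l, i != j.
  apply/existsP; rewrite -negb_forall; apply/negP=> /forallP eqi.
  have : (#|'I_l| <= 1)%N.
    by apply/card_le1P=> x _ y; rewrite !inE -(eqP (eqi x)) eq_sym -(eqP (eqi y)) eqxx.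
  by rewrite card_ord leqNgt l1.
have wE' i j y k m : i != j -> (if m == j then w k i * y else 0) = if k == i then y * w j m else 0.
  move=> ij; have /matrixP/(_ k m) := wE i j y ij.
  by rewrite gl_lieE mxE [X in _ + X]mxE eij_mul mul_eij mxE => /subr0_eq.
have woff k i : k != i -> w k i = 0.
  move=> ki; have [j ij] := other i; have := wE' i j 1 k j ij.
  by rewrite eqxx (negbTE ki) mulr1.
have wd i j y : i != j -> w i i * y = y * w j j.
  by move=> ij; have := wE' i j y i j ij; rewrite !eqxx.
move=> x; apply/matrixP=> i j; rewrite gl_lieE [RHS]mxE mxE [X in _ + X]mxE.
rewrite !gl_mulE (bigD1 i) //= big1 ?addr0 => [|k ki]; last by rewrite woff ?mul0r // eq_sym.
rewrite (bigD1 j) //= big1 ?addr0 => [|k kj]; last by rewrite woff ?mulr0.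
case: (eqVneq i j) => [->|ij]; last by rewrite (wd i j) // subrr.
have [k jk] := other j; have := wd j k 1 jk; rewrite mulr1 mul1r => wjk.
by rewrite (wd j k) // wjk subrr.
Qed.

End ScalarMatrices.

Section Centroid.
Variables (K : fieldType) (A : algType K) (l : nat) (chi : gl A l -> gl A l).
Local Notation S := (in_derived (L := gl A l)).
Hypotheses (K0 : [pchar K] =i pred0) (l1 : (1 < l)%N).
Hypothesis chi_lin : forall c x y, x \in S -> y \in S ->
  chi (c *: x + y) = c *: chi x + chi y.
Hypothesis chi_lie : forall x y, x \in S -> y \in S ->
  chi (lie x y) = lie (chi x) y /\ chi (lie x y) = lie x (chi y).

Let natr0 (m : nat) : (m%:R == 0 :> K) = (m == 0)%N.
Proof. by move/pcharf0P: K0. Qed.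

(** The diagonal of the coroot [E_pp - E_qq], shifted by one so that weights can be compared as
    natural numbers. *)
Definition sl2_weight (p q i : 'I_l) : nat :=
  if i == p then 2 else if i == q then 0 else 1.
Local Notation s p q := (fun i => (sl2_weight p q i)%:R - 1 : K).

Lemma sl2_coroot p q : p != q ->
  lie (eij p q 1) (eij q p 1) = scalar_diag A (s p q).
Proof.
move=> pq; rewrite gl_lieE !eijM !eqxx mulr1; apply/matrixP=> i j.
rewrite mxE [X in _ + X]mxE !eijE mxE /sl2_weight.
case: (eqVneq i j) => [<-|ij].
  rewrite !andbb; case: (eqVneq i p) => [->|ip].
    by rewrite (negbTE pq) subr0 -[2%:R]/(1 + 1) addrK scale1r.
  case: (eqVneq i q) => [_|_]; first by rewrite !sub0r scaleN1r.
  by rewrite !subrr scale0r.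
have nij (k : 'I_l) : (i == k) && (j == k) = false.
  by apply/negbTE; apply: contra ij => /andP[/eqP -> /eqP ->].
by rewrite !nij subrr.
Qed.

Lemma sl2_eigen p q (w : gl A l) : p != q ->
  lie (scalar_diag A (s p q)) w = 2%:R *: w -> w = eij p q (w p q).
Proof.
move=> pq hw; apply/matrixP=> i j; rewrite eijE.
case: (boolP ((i == p) && (j == q))) => [/andP[/eqP -> /eqP ->] //|nij].
move/matrixP/(_ i j): hw; rewrite lie_scalar_diag gl_scaleE => /eqP.
rewrite -subr_eq0 -scalerBl scaler_eq0 => /orP[|/eqP //].
rewrite opprB addrA subrK subr_eq0 subr_eq -natrD => /eqP/(pchar0_natr_inj K0).
move: nij; rewrite /sl2_weight; case: (i == p) => /=; last first.
  by case: (i == q); case: (j == p) (j == q) => -[].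
by case: (j == p); case: (j == q).
Qed.

Let ES i j y : i != j -> eij i j y \in S. Proof. exact: eij_derived. Qed.

(** [chi] commutes with the adjoint action of the coroot, and by [sl2_eigen] the eigenvalue 2 occurs
    at the position [(p, q)] only. *)
Lemma centroid_root p q : p != q -> exists c, chi (eij p q 1) = eij p q c.
Proof.
move=> pq; exists (chi (eij p q 1) p q); apply: sl2_eigen => //.
rewrite -sl2_coroot // -(chi_lie _ _).2 ?lie_in_derived ?ES //.
have -> : lie (lie (eij p q 1) (eij q p 1)) (eij p q 1) = 2%:R *: eij p q (1 : A).
  rewrite !gl_lieE !eijM !eqxx mulrBl mulrBr !eijM !eqxx (eq_sym q p) (negbTE pq).
  by rewrite subr0 sub0r opprK !mulr1 scaler_nat mulr2n.
have S0 : (0 : gl A l) \in S by exact: rpred0.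
have chi0 : chi 0 = 0.
  by have := chi_lin (-1) S0 S0; rewrite scaler0 addr0 scaleN1r addNr.
by rewrite -[_ *: _]addr0 chi_lin ?ES // chi0 addr0.
Qed.

(* [chi] maps the root vector [E_pq] to [c E_pq] with [c] central; the kernel of
   [chi - c] is an ideal containing all off-diagonal matrices, so the image of
   [chi - c] is central and [chi - c] kills all brackets. *)
Lemma centroid_scalar : exists2 z, forall y, z * y = y * z &
  forall x y, x \in S -> y \in S -> chi (lie x y) = gl_scalar l z * lie x y.
Proof.
have [p [q pq]] : exists p q : 'I_l, p != q.
  by exists (Ordinal (ltnW l1)), (Ordinal l1).
have qp : q != p by rewrite eq_sym.
have [c Ec] := centroid_root pq; have [c' Ec'] := centroid_root qp.
have corner y : lie (eij p q 1) (eij q p y) = eij p p y - eij q q y.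
  by rewrite gl_lieE !eijM !eqxx mul1r mulr1.
have corner' y : lie (eij p q y) (eij q p 1) = eij p p y - eij q q y.
  by rewrite gl_lieE !eijM !eqxx mul1r mulr1.
have entry (u v u' v' : A) : eij p p u - eij q q v = eij p p u' - eij q q v' -> u = u'.
  move/matrixP/(_ p p); rewrite mxE [X in _ + X]mxE [RHS]mxE [X in _ = _ + X]mxE !eijE.
  by rewrite eqxx (negbTE pq) !subr0.
have cc' : c = c'.
  have [e1 e2] := chi_lie (ES 1 pq) (ES 1 qp).
  move: e1; rewrite e2 Ec Ec' corner corner' => /entry //.
have cC y : c * y = y * c.
  have [e1 _] := chi_lie (ES 1 pq) (ES y qp); have [_ e2] := chi_lie (ES y pq) (ES 1 qp).
  move: e1; rewrite corner -corner' e2 Ec Ec' -cc' !gl_lieE !eijM !eqxx.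
  by move/entry.
exists c => //.
pose chi' x := chi x - gl_scalar l c * x.
have chi'_lin k x y : x \in S -> y \in S -> chi' (k *: x + y) = k *: chi' x + chi' y.
  move=> Sx Sy; rewrite /chi' chi_lin // mulrDr -gl_scaleAr scalerBr opprD addrACA.
  by [].
have chi'_lie x y : x \in S -> y \in S ->
    chi' (lie x y) = lie (chi' x) y /\ chi' (lie x y) = lie x (chi' y).
  move=> Sx Sy; have [e1 e2] := chi_lie Sx Sy; rewrite /chi'; split.
    by rewrite e1 -lie_gl_scalar // lieBl.
  by rewrite e2 -lie_gl_scalarr // lieBr.
pose I x := x \in S /\ chi' x = 0.
have Ilie x y : I x -> y \in S -> I (lie x y).
  move=> [Sx x0] Sy; split; first exact: lie_in_derived.
  by rewrite (chi'_lie _ _ Sx Sy).1 x0 gl_lieE mul0r mulr0 subrr.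
have IZ k x : I x -> I (k *: x).
  move=> [Sx x0]; split; first exact: rpredZ.
  have S0 : (0 : gl A l) \in S by exact: rpred0.
  have chi'0 : chi' 0 = 0.
    by have := chi'_lin (-1) 0 0 S0 S0; rewrite scaler0 addr0 scaleN1r addNr.
  by rewrite -[_ *: _]addr0 chi'_lin // x0 chi'0 scaler0 addr0.
have I12 : I (eij p q 1).
  split; first exact: ES.
  rewrite /chi' Ec; apply/eqP; rewrite subr_eq0; apply/eqP/matrixP=> i j.
  by rewrite gl_scalarE !eijE; case: ifP; rewrite ?mulr0 ?mulr1.
have Ih : I (scalar_diag A (s p q)) by rewrite -sl2_coroot //; apply: Ilie => //; exact: ES.
(* Such a root vector is an eigenvector of the coroot for a non-zero eigenvalue, and the coroot lies
   in the ideal [I]. *)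
have Iroot i j y : i != j -> sl2_weight p q i != sl2_weight p q j -> I (eij i j y).
  move=> ij sij; pose k : K := (sl2_weight p q i)%:R - (sl2_weight p q j)%:R.
  have k0 : k != 0.
    by rewrite subr_eq0; apply: contra sij => /eqP/(pchar0_natr_inj K0) ->.
  have -> : eij i j y = k^-1 *: lie (scalar_diag A (s p q)) (eij i j y).
    apply/matrixP=> a b; rewrite gl_scaleE lie_scalar_diag eijE.
    case: ifP => [/andP[/eqP -> /eqP ->]|_]; last by rewrite !scaler0.
    by rewrite opprB addrA subrK scalerA mulVf ?scale1r.
  by apply/IZ/Ilie => //; exact: ES.
(* Distinct indices of equal weight both differ from [p]; the root vector is then a bracket through
   [p], whose first factor is covered by [Iroot]. *)
have Iall i j y : i != j -> I (eij i j y).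
  move=> ij; case: (eqVneq (sl2_weight p q i) (sl2_weight p q j)) => [sij|]; last exact: Iroot.
  have ip : i != p.
    apply: contraNneq ij => ip; move: sij; rewrite ip /sl2_weight eqxx.
    by case: eqP => [->|_] //; case: ifP.
  have jp : j != p.
    apply: contraNneq ij => jp; move: sij; rewrite jp /sl2_weight eqxx.
    by case: (i == p) => //; case: (i == q).
  have -> : eij i j y = lie (eij i p y) (eij p j 1).
    by rewrite gl_lieE !eijM eqxx eq_sym (negbTE ij) subr0 mulr1.
  apply: Ilie; last by apply: ES; rewrite eq_sym.
  apply: Iroot => //; rewrite /sl2_weight eqxx (negbTE ip).
  by case: ifP.
have chi'C x y : x \in S -> lie (chi' x) y = 0.
  move=> Sx; apply: commute_eij_central => // i j a ij.
  have [Sij ij0] := Iall i j a ij; have [e1 e2] := chi'_lie _ _ Sx Sij.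
  by rewrite -e1 e2 ij0 gl_lieE mulr0 mul0r subrr.
move=> x y Sx Sy; apply/eqP; rewrite -subr_eq0 -/(chi' _); apply/eqP.
by rewrite (chi'_lie _ _ Sx Sy).1 chi'C.
Qed.

End Centroid.

Lemma commutation_bicharacter (K : fieldType) (Q : algType K) (G : zmodType)
    (X : G -> Q) (XB : torus_basis X) : bicharacter (commutation XB).
Proof.
split; [exact: commutation_neq0|exact: commutationDl|exact: commutationDr].
Qed.

Lemma radicalr (K : fieldType) (Q : algType K) (G : zmodType) (X : G -> Q)
  (XB : torus_basis X) a : radical XB a <-> forall b, commutation XB b a = 1.
Proof.
by split=> ra b; rewrite commutation_sym ra invr1.
Qed.

Section CentralTransport.
Variables (K : fieldType) (A' A : algType K) (r : nat).
Variables (F : gl A' r.+1 -> gl A r.+1) (G : gl A r.+1 -> gl A' r.+1).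
Hypotheses (K0 : [pchar K] =i pred0) (FG : sl_inverse F G) (r0 : (0 < r)%N).
Local Notation S' := (in_derived (L := gl A' r.+1)).
Local Notation S := (in_derived (L := gl A r.+1)).

Let Fm : sl_morphism F. Proof. by case: FG. Qed.
Let Gm : sl_morphism G. Proof. by case: FG. Qed.

(** Multiplication by [z'] lies in the centroid; conjugated by [F] it lies in the centroid of the
    other algebra, so [centroid_scalar] applies, which describes it on brackets. *)
Lemma central_transport (z' : A') : (forall y, z' * y = y * z') ->
  exists2 z, forall y, z * y = y * z & forall x y, x \in S' -> y \in S' ->
    F (gl_scalar r.+1 z' * lie x y) = gl_scalar r.+1 z * F (lie x y).
Proof.
move=> zc; have [_ _ GF FGK] := FG.
pose chi y := F (gl_scalar r.+1 z' * G y).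
have SG y : y \in S -> gl_scalar r.+1 z' * G y \in S'.
  by move=> Sy; apply: gl_scalar_derived => //; exact: slm_in.
have chi_lin c x y : x \in S -> y \in S -> chi (c *: x + y) = c *: chi x + chi y.
  by move=> Sx Sy; rewrite /chi (slm_lin Gm) // mulrDr -gl_scaleAr (slm_lin Fm) ?SG.
have chi_lie x y : x \in S -> y \in S ->
    chi (lie x y) = lie (chi x) y /\ chi (lie x y) = lie x (chi y).
  move=> Sx Sy; rewrite /chi (slm_lie Gm) //; split.
    by rewrite -lie_gl_scalar // (slm_lie Fm) ?SG ?FGK ?slm_in.
  by rewrite -lie_gl_scalarr // (slm_lie Fm) ?SG ?FGK ?slm_in.
have [z zC zE] := centroid_scalar K0 (r0 : (1 < r.+1)%N) chi_lin chi_lie.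
exists z => // x y Sx Sy.
have := zE (F x) (F y); rewrite -(slm_lie Fm) // /chi GF ?lie_in_derived //.
by apply; exact: slm_in.
Qed.

(** Puts corners in the bracket form required by [central_transport]: the bracket of the two corners
    of 1 acts on the upper one with eigenvalue 2. *)
Lemma corner_bracket (B : algType K) (b : B) : exists x y : gl B r.+1,
  [/\ x \in in_derived (L := gl B r.+1), y \in in_derived (L := gl B r.+1)
    & eij ord0 ord_max b = lie x y].
Proof.
have max0 : (ord_max : 'I_r.+1) != ord0 by rewrite -val_eqE /= -lt0n.
have two0 : 2%:R != 0 :> K by move/pcharf0P: K0 => ->.
exists (2%:R^-1 *: lie (eij ord0 ord_max 1) (eij ord_max ord0 1)), (eij ord0 ord_max b).
split; [by apply: rpredZ; exact: lie_in_derived|exact: corner_derived|].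
rewrite gl_lieE -gl_scaleAl -gl_scaleAr -scalerBr gl_lieE !eijM !eqxx.
rewrite mulrBl mulrBr !eijM !eqxx (negbTE max0) subr0 sub0r opprK !mulr1 mul1r.
by rewrite -mulr2n -scaler_nat scalerA mulVf // scale1r.
Qed.

End CentralTransport.

Section RadicalTransport.
Variables (K : fieldType) (Q' Q : algType K) (r : nat).
Variables (F : gl Q' r.+1 -> gl Q r.+1) (G : gl Q r.+1 -> gl Q' r.+1).
Hypotheses (K0 : [pchar K] =i pred0) (FG : sl_inverse F G) (r0 : (0 < r)%N).
Variables (n n' : nat) (X : 'rV[int]_n -> Q) (X' : 'rV[int]_n' -> Q').
Hypotheses (XB : torus_basis X) (XB' : torus_basis X').
Local Notation ord := (lex_translation_order n).
Local Notation S' := (in_derived (L := gl Q' r.+1)).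
Local Notation E b := (F (eij ord0 ord_max b)).

Let Fm : sl_morphism F. Proof. by case: FG. Qed.

Lemma gl_scalarM (z w : Q) : gl_scalar r.+1 z * gl_scalar r.+1 w = gl_scalar r.+1 (z * w).
Proof. by apply/matrixP=> i j; rewrite gl_scalarE !mxE mulrnAr. Qed.

Lemma gl_scalar_scale (B : algType K) (c : K) (z : B) (x : gl B r.+1) :
  gl_scalar r.+1 (c *: z) * x = c *: (gl_scalar r.+1 z * x).
Proof. by apply/matrixP=> i j; rewrite gl_scaleE !gl_scalarE scalerAl. Qed.

Lemma gl_scalar_cancel (z w : Q) (x : gl Q r.+1) : x != 0 ->
  gl_scalar r.+1 z * x = gl_scalar r.+1 w * x -> z = w.
Proof.
move=> x0 zw; apply/eqP; rewrite -subr_eq0; apply: contraNT x0 => zw0.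
apply/eqP/matrixP=> i j; rewrite [RHS]mxE.
move/matrixP/(_ i j): zw; rewrite !gl_scalarE => e; apply/eqP.
apply: contraTT isT => xij; have := basis_domain XB ord zw0 xij.
by rewrite mulrBl e subrr eqxx.
Qed.

(** Let [z] and [w] be the transports of [X' a] and [X' (- a)]. Their product is a non-zero scalar,
    so [z] is a unit, hence a monomial by [unit_monomial], and it is central. *)
Lemma radical_transport a : radical XB' a -> exists p c,
  [/\ c != 0, radical XB p & forall x y, x \in S' -> y \in S' ->
    F (gl_scalar r.+1 (X' a) * lie x y) = c *: (gl_scalar r.+1 (X p) * F (lie x y))].
Proof.
move=> ra; have rNa := radicalN ra.
have [z zC zE] := central_transport K0 FG r0 (radical_central ra).
have [w wC wE] := central_transport K0 FG r0 (radical_central rNa).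
have [s s0 XX] := tbM XB' a (- a).
have zw : z * w = s%:A.
  have [x [y [Sx Sy xy]]] := corner_bracket K0 r0 (1 : Q').
  apply: (gl_scalar_cancel (corner_image_neq0 FG r0 (oner_neq0 Q'))).
  rewrite -gl_scalarM -mulrA xy -wE // -lie_gl_scalarr; last exact: radical_central rNa.
  rewrite -zE //; last by apply: gl_scalar_derived => //; exact: radical_central rNa.
  rewrite lie_gl_scalarr; last exact: radical_central rNa.
  rewrite mulrA.
  have -> : gl_scalar r.+1 (X' a) * gl_scalar r.+1 (X' (- a)) = gl_scalar r.+1 (s *: (1 : Q')).
    by apply/matrixP=> i j; rewrite gl_scalarE !mxE mulrnAr XX subrr (tb0 XB').
  rewrite !gl_scalar_scale (slmZ Fm).
    by congr (_ *: _); apply: etrans (esym _); [|apply: mul1r]; rewrite ?mul1r.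
  by rewrite mul1r lie_in_derived.
have zw1 : z * (s^-1 *: w) = 1 by rewrite -scalerAr zw scalerA mulVf // scale1r.
have [c c0 [p zp]] := unit_monomial XB ord zw1; exists p, c; split=> //.
  by apply: (central_radical XB c0) => y; rewrite -zp zC.
by move=> x y Sx Sy; rewrite zE // zp gl_scalar_scale.
Qed.

End RadicalTransport.

(** * Bijectivity of the exponent map *)

Section RadicalBijection.
Variables (K : fieldType) (Q' Q : algType K) (r : nat).
Variables (F : gl Q' r.+1 -> gl Q r.+1) (G : gl Q r.+1 -> gl Q' r.+1).
Hypotheses (K0 : [pchar K] =i pred0) (FG : sl_inverse F G) (r0 : (0 < r)%N).
Variables (n n' : nat) (X : 'rV[int]_n -> Q) (X' : 'rV[int]_n' -> Q').
Hypotheses (XB : torus_basis X) (XB' : torus_basis X').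
Local Notation ord := (lex_translation_order n).
Local Notation S' := (in_derived (L := gl Q' r.+1)).
Local Notation E b := (F (eij ord0 ord_max b)).
Local Notation beta := (commutation XB).
Local Notation beta' := (commutation XB').

Let Fm : sl_morphism F. Proof. by case: FG. Qed.
Let Gm : sl_morphism G. Proof. by case: FG. Qed.

(** Corners with central entries are scalar multiples of the corner of 1, to which the transport
    results apply. *)
Lemma gl_scalar_eij (B : algType K) (z b : B) i j :
  gl_scalar r.+1 z * eij i j b = eij i j (z * b).
Proof. by apply/matrixP=> k m; rewrite gl_scalarE !eijE; case: ifP; rewrite ?mulr0. Qed.

(** On the radical, [phi] is the exponent of the transported central monomial, by the last clause of
    [exponent_map]. Injectivity there comes from that of [F], surjectivity from transporting
    backwards along [G]. *)
Lemma exponent_map_radical : exists phi : 'rV[int]_n' -> 'rV[int]_n,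
  [/\ forall a b, phi (a + b) = phi a + phi b,
      forall a b, beta (phi a) (phi b) = beta' a b \/ beta (phi a) (phi b) = (beta' a b)^-1,
      forall a, radical XB' a -> phi a = 0 -> a = 0
    & forall p, radical XB p -> exists2 a, radical XB' a & phi a = p].
Proof.
have [phi [phiD phi_beta phi_lead]] := exponent_map K0 FG r0 XB XB'.
have [_ _ GF FGK] := FG.
have [x [y [Sx Sy xy]]] := corner_bracket K0 r0 (1 : Q').
have S1 : eij ord0 ord_max 1 \in S' by rewrite xy lie_in_derived.
have E10 := corner_image_neq0 FG r0 (oner_neq0 Q').
have phi_rad a : radical XB' a -> exists2 c, c != 0 &
    E (X' a) = c *: (gl_scalar r.+1 (X (phi a)) * E 1).
  move=> /(radical_transport K0 FG r0 XB)[p [c [c0 _ pE]]].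
  have Ea : E (X' a) = c *: (gl_scalar r.+1 (X p) * E 1).
    by rewrite xy -pE // -xy gl_scalar_eij mulr1.
  have z0 : c *: X p != 0 by rewrite scaler_eq0 (negbTE c0) (negbTE (tb_neq0 XB p)).
  have [|d ld] := phi_lead a _ z0.
    by move=> i j; rewrite Ea gl_scaleE gl_scalarE scalerAl.
  have [<- _] := leading_uniq ord (leading_monomial XB _ p c0) ld.
  by exists c.
exists phi; split=> //.
- move=> a /phi_rad[c c0]; move=> Ea phi0; move: Ea; rewrite phi0 (tb0 XB).
  have -> : gl_scalar r.+1 1 * E 1 = E 1 by apply/matrixP=> i j; rewrite gl_scalarE mul1r.
  rewrite -(slmZ Fm) // -eijZ => /(congr1 G); rewrite !GF ?corner_derived // => /eij_inj.
  by rewrite -(tb0 XB') -[X' a]scale1r => /(monomial_inj XB' (oner_neq0 K)).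
- move=> p rp.
  have [a [c [c0 ra aE]]] := radical_transport K0 (sl_inverse_sym FG) r0 XB' rp.
  exists a => //; have [d d0 Ea] := phi_rad a ra.
  have := aE (F x) (F y) (slm_in Fm Sx) (slm_in Fm Sy).
  rewrite -(slm_lie Fm) // -xy GF // gl_scalar_eij mulr1 -eijZ => /(congr1 F).
  rewrite FGK; last first.
    by apply: gl_scalar_derived; [exact: radical_central rp|exact: slm_in].
  rewrite eijZ (slmZ Fm) ?corner_derived // Ea scalerA -gl_scalar_scale.
  move/(gl_scalar_cancel XB E10); rewrite -[X p]scale1r.
  by move/(monomial_inj XB (oner_neq0 K)).
Qed.

End RadicalBijection.

Section ExponentBijection.
Variables (K : fieldType) (Q' Q : algType K) (r : nat).
Variables (F : gl Q' r.+1 -> gl Q r.+1) (G : gl Q r.+1 -> gl Q' r.+1).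
Hypotheses (K0 : [pchar K] =i pred0) (FG : sl_inverse F G) (r0 : (0 < r)%N).
Variables (n n' : nat) (X : 'rV[int]_n -> Q) (X' : 'rV[int]_n' -> Q').
Hypotheses (XB : torus_basis X) (XB' : torus_basis X').

(** The square of [theta] preserves [b] whatever the sign, so [isometry_surjective] applies to
    it. *)
Lemma signed_isometry_surjective (m : nat) (b : 'rV[int]_m -> 'rV[int]_m -> K)
    (theta : 'rV[int]_m -> 'rV[int]_m) (R : 'rV[int]_m -> Prop) :
  bicharacter b -> (forall x y, theta (x + y) = theta x + theta y) ->
  (forall x y, b (theta x) (theta y) = b x y) \/
  (forall x y, b (theta x) (theta y) = (b x y)^-1) ->
  (forall p, R p <-> forall x, b x p = 1) ->
  (forall p, R p -> exists2 x, R x & theta x = p) ->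
  forall y, exists x, theta x = y.
Proof.
move=> bb thetaD bt RE Rt y.
pose t x := theta (theta x).
have tD u v : t (u + v) = t u + t v by rewrite /t !thetaD.
have tb u v : b (t u) (t v) = b u v.
  by rewrite /t; case: bt => bt; rewrite !bt ?invrK.
have tR p : (forall x, b x p = 1) -> exists x, t x = p.
  by move=> /RE/Rt[u /Rt[v _ <-] <-]; exists v.
by have [x xy] := isometry_surjective bb tD tb tR y; exists (theta x).
Qed.

Lemma exponent_bijection : exists phi : 'rV[int]_n' -> 'rV[int]_n,
  [/\ bijective phi, forall a b, phi (a + b) = phi a + phi b
    & (forall a b, commutation XB (phi a) (phi b) = commutation XB' a b) \/
      (forall a b, commutation XB (phi a) (phi b) = (commutation XB' a b)^-1)].
Proof.
have sub m m' (Q1 Q2 : algType K) (X1 : 'rV[int]_m -> Q1) (X2 : 'rV[int]_m' -> Q2)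
    (B1 : torus_basis X1) (B2 : torus_basis X2) (f : 'rV[int]_m -> 'rV[int]_m') :
    (forall a b, f (a + b) = f a + f b) ->
    (forall a b, commutation B2 (f a) (f b) = commutation B1 a b \/
      commutation B2 (f a) (f b) = (commutation B1 a b)^-1) ->
    (forall a b, commutation B2 (f a) (f b) = commutation B1 a b) \/
    (forall a b, commutation B2 (f a) (f b) = (commutation B1 a b)^-1).
  move=> fD fB; apply: bicharacter_uniform_sign => //; last exact: commutation_bicharacter.
  by split=> *; rewrite ?fD; [exact: commutation_neq0|exact: commutationDl|exact: commutationDr].
have [phi [phiD phiB phi_inj phi_rad]] := exponent_map_radical K0 FG r0 XB XB'.
have [psi [psiD psiB psi_inj psi_rad]] := exponent_map_radical K0 (sl_inverse_sym FG) r0 XB' XB.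
have phi_pm := sub _ _ _ _ _ _ XB' XB phi phiD phiB.
have psi_pm := sub _ _ _ _ _ _ XB XB' psi psiD psiB.
have phi_psi : forall y, exists x, phi (psi x) = y.
  apply: (signed_isometry_surjective (b := commutation XB) (theta := phi \o psi) (R := radical XB)).
  - exact: commutation_bicharacter.
  - by move=> x y /=; rewrite psiD phiD.
  - by case: phi_pm => e; case: psi_pm => e'; [left|right|right|left] => x y /=;
      rewrite e e' ?invrK.
  - exact: radicalr.
  - by move=> p /phi_rad[a /psi_rad[a' ra' <-] <-]; exists a'.
exists phi; split=> //.
have phi0 : phi 0 = 0 by apply: (addrI (phi 0)); rewrite -phiD !addr0.
have phiN a : phi (- a) = - phi a.
  by apply: (addrI (phi a)); rewrite -phiD !subrr phi0.
(* If [phi] takes the same value at [a] and [a'], their difference pairs trivially with every [b],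
   so it is in the radical, where [phi] has trivial kernel. *)
have inj : injective phi.
  move=> a a' aa'; apply: subr0_eq; apply: phi_inj; last by rewrite phiD phiN aa' subrr.
  move=> b; have := commutation0l XB (phi b).
  rewrite -[0](subrr (phi a)) {2}aa' -phiN -phiD.
  by case: phi_pm => -> // /(congr1 GRing.inv); rewrite invrK invr1.
have [g gK] : exists g, cancel g phi.
  by have [g gP] := choice phi_psi; exists (psi \o g).
by exists g => // a; apply: inj; rewrite gK.
Qed.

End ExponentBijection.

(** * Isomorphisms of quantum tori *)

(** The opposite ring with unchanged scalars is a [K]-algebra, so anti-isomorphisms become algebra
    morphisms into it. *)
HB.instance Definition _ (K : pzRingType) (A : algType K) := GRing.Lmodule.on A^c.

HB.instance Definition _ (K : pzRingType) (A : algType K) :=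
  GRing.Lmodule_isLalgebra.Build K A^c (fun k a b => @scalerAr K A k b a).
HB.instance Definition _ (K : pzRingType) (A : algType K) :=
  GRing.Lalgebra_isAlgebra.Build K A^c (fun k a b => @scalerAl K A k b a).

Section ConverseTorus.
Variables (K : fieldType) (Q : algType K) (G : zmodType) (X : G -> Q).
Hypothesis XB : torus_basis X.

Lemma converse_torus_basis : torus_basis (X : G -> Q^c).
Proof.
split; [exact: (tb0 XB)| |exact: (tb_free XB)|exact: (tb_span XB)].
by move=> a b; have [c c0 XX] := tbM XB b a; exists c => //; rewrite addrC.
Qed.

Lemma converse_commutation a b :
  commutation converse_torus_basis a b = (commutation XB a b)^-1.
Proof.
rewrite -commutation_sym; apply: commutation_uniq.
exact: (commutationE XB b a).
Qed.

End ConverseTorus.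

Section TorusIsomorphism.
Variables (K : fieldType) (K0 : [pchar K] =i pred0).
Variables (n' n : nat) (q : 'M[K]_n') (Q' Q : algType K) (x y : 'I_n' -> Q').
Hypotheses (qP : quantum_matrix q) (presQ : torus_presentation q x y).
Variables (X : 'rV[int]_n -> Q).
Hypothesis XB : torus_basis X.
Local Notation X' := (torus_mono x y).
Local Notation XB' := (presentation_basis K0 qP presQ).
Local Notation delta i := (\row_j (if j == i then 1 else 0) : 'rV[int]_n').

(** The monomials [X (phi (delta i))] satisfy the defining relations of [Q'], which yields [theta];
    it maps a basis to a basis up to scalars because [phi] is bijective. *)
Lemma torus_isomorphism (phi : 'rV[int]_n' -> 'rV[int]_n) : bijective phi ->
  (forall a b, phi (a + b) = phi a + phi b) ->
  (forall a b, commutation XB (phi a) (phi b) = commutation XB' a b) ->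
  exists theta : {lrmorphism Q' -> Q}, bijective theta.
Proof.
move=> [g gK Kg] phiD phiB; have [q0 _ _] := qP; have [[xy yx qxy] univ] := presQ.
have phi0 : phi 0 = 0 by apply: (addrI (phi 0)); rewrite -phiD !addr0.
have phiN a : phi (- a) = - phi a.
  by apply: (addrI (phi a)); rewrite -phiD !subrr phi0.
have X'delta i : X' (delta i) = x i by rewrite torus_mono_delta /= expr1.
have inv a : exists2 c : K, c != 0 & X a * (c *: X (- a)) = 1 /\ (c *: X (- a)) * X a = 1.
  have [c c0 XX] := tbM XB a (- a); rewrite subrr (tb0 XB) in XX.
  exists c^-1; rewrite ?invr_eq0 //; split.
    by rewrite -scalerAr XX scalerA mulVf // scale1r.
  rewrite -scalerAl (commutationE XB) XX commutationNl.
  have -> : commutation XB a a = 1.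
    by apply: commutation_uniq; rewrite scale1r.
  by rewrite invr1 scale1r scalerA mulVf // scale1r.
pose u i := X (phi (delta i)).
have ex_v i : exists w : Q, u i * w = 1 /\ w * u i = 1.
  have [c _ [E1 E2]] := inv (phi (delta i)).
  by exists (c *: X (- phi (delta i))).
have [v vP] := choice ex_v.
have rel : torus_relations q u v.
  split=> [i|i|i j]; [by case: (vP i)|by case: (vP i)|].
  rewrite /u (commutationE XB) phiB; congr (_ *: _).
  by apply: commutation_uniq; rewrite !X'delta.
have [theta [theta_uv _]] := univ _ u v rel; exists theta.
(* The exponents satisfying [P] form a subgroup containing the standard basis, hence are all of the
   lattice. *)
pose P a := exists2 c : K, c != 0 & theta (X' a) = c *: X (phi a).
have P0 : P 0.
  by exists 1; rewrite ?oner_eq0 // scale1r (tb0 XB') rmorph1 phi0 (tb0 XB).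
have PD a b : P a -> P b -> P (a + b).
  move=> [c c0 Ea] [d d0 Eb]; have [s s0 XX] := tbM XB' a b.
  have [t t0 YY] := tbM XB (phi a) (phi b).
  exists (s^-1 * (c * d * t)); first by rewrite !mulf_neq0 ?invr_eq0.
  have := congr1 theta XX; rewrite rmorphM linearZ /= Ea Eb -scalerAl -scalerAr YY phiD !scalerA.
  move=> E1; rewrite -[LHS]scale1r -(mulVf s0) -scalerA -E1 !scalerA.
  by [].
have PN a : P a -> P (- a).
  move=> [c c0 Ea]; have [s s0 XX] := tbM XB' (- a) a.
  have [t t0 [E1 _]] := inv (phi a).
  exists (s * c^-1 * t); first by rewrite !mulf_neq0 ?invr_eq0.
  have := congr1 theta XX; rewrite addNr (tb0 XB') rmorphM linearZ /= rmorph1 Ea => E2.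
  have {}E2 : theta (X' (- a)) * X (phi a) = (c^-1 * s) *: 1.
    by apply: (scalerI c0); rewrite scalerAr E2 scalerA mulVKf.
  rewrite -[LHS]mulr1 -E1 mulrA E2 phiN -scalerAl mul1r scalerA.
  by rewrite [c^-1 * s]mulrC.
have Pdelta i : P (delta i).
  by exists 1; rewrite ?oner_eq0 // scale1r X'delta (theta_uv i).1.
have PM a k : P a -> P (a *~ k).
  move=> Pa; have PMn (m : nat) : P (a *+ m).
    by elim: m => [|m IHm]; rewrite ?mulr0n // mulrS; exact: PD.
  by case: k => m; [exact: PMn|rewrite NegzE mulrNz; apply/PN/PMn].
have Pall a : P a.
  have -> : a = \sum_i delta i *~ a 0 i.
    apply/rowP=> j; rewrite summxE (bigD1 j) //= big1 ?addr0 => [|i ij].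
      by rewrite -scaler_int mxE !mxE eqxx mulr1 intz.
    by rewrite -scaler_int mxE !mxE eq_sym (negbTE ij) mulr0.
  by apply: (big_ind P) => // i _; apply: PM.
have ex_c a : exists c : K, c != 0 /\ theta (X' a) = c *: X (phi a).
  by have [c c0 E1] := Pall a; exists c.
have [c cP] := choice ex_c.
have theta_inj : injective theta.
  move=> z w zw; apply: subr0_eq; have : theta (z - w) = 0 by rewrite raddfB /= zw subrr.
  move: (z - w) => {w zw} z' z0; apply: (tcoef_eq0 (XB := XB')) => a.
  apply/eqP; apply/negPn/negP; rewrite -mem_supp => as_.
  have : \sum_(b <- map phi (supp XB' z')) (tcoef XB' z' (g b) * c (g b)) *: X b = 0.
    rewrite big_map -[RHS]z0 [in RHS](tcoefE XB' z') raddf_sum; apply: eq_bigr => b _.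
    by rewrite gK /= linearZ /= (cP b).2 scalerA.
  move/(tb_free XB) => /(_ _ (phi a)).
  rewrite map_inj_uniq ?supp_uniq; last exact: can_inj gK.
  move=> /(_ isT (map_f phi as_)) /eqP; rewrite gK mulf_eq0 (negbTE (cP a).1) orbF.
  by apply/negP; rewrite -mem_supp.
have theta_surj w : exists z, theta z = w.
  exists (\sum_(b <- supp XB w) (tcoef XB w b / c (g b)) *: X' (g b)).
  rewrite raddf_sum [RHS](tcoefE XB); apply: eq_bigr => b _ /=.
  by rewrite linearZ /= (cP _).2 Kg scalerA mulfVK // (cP _).1.
have [h hK] := choice theta_surj.
by exists h => // z; apply: theta_inj; rewrite hK.
Qed.

End TorusIsomorphism.

(** * Conjugacy *)

Local Open Scope classical_set_scope.

Section Restriction.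
Variables (K : fieldType) (A' A : algType K) (l' l : nat).
Local Notation S' := (in_derived (L := gl A' l')).
Local Notation S := (in_derived (L := gl A l)).

(* Only meaningful on [sl]: elsewhere the value is the junk [f 0]. *)
Definition sl_extend (f : sl A' l' -> sl A l) (x : gl A' l') : gl A l :=
  val (f (insubd (0 : sl A' l') x)).

Lemma sl_extend_val (f : sl A' l' -> sl A l) (x : sl A' l') :
  sl_extend f (val x) = val (f x).
Proof. by rewrite /sl_extend valKd. Qed.

Lemma sl_extend_morphism (f : sl A' l' -> sl A l) :
  (forall c x y, f (c *: x + y) = c *: f x + f y) ->
  (forall x y, f (lie x y) = lie (f x) (f y)) -> sl_morphism (sl_extend f).
Proof.
move=> f_lin f_lie; split=> [x _|c x y Sx Sy|x y Sx Sy].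
- exact: valP.
- have -> : c *: x + y = val (c *: (DerivedAlgebra Sx : sl A' l') + DerivedAlgebra Sy) by [].
  rewrite -[X in _ = _ *: sl_extend f X + _]/(val (DerivedAlgebra Sx : sl A' l')).
  rewrite -[X in _ = _ + sl_extend f X]/(val (DerivedAlgebra Sy : sl A' l')).
  by rewrite !sl_extend_val f_lin.
- have -> : lie x y = val (lie (DerivedAlgebra Sx : sl A' l') (DerivedAlgebra Sy)) by [].
  rewrite -[X in _ = lie (sl_extend f X) _]/(val (DerivedAlgebra Sx : sl A' l')).
  rewrite -[X in _ = lie _ (sl_extend f X)]/(val (DerivedAlgebra Sy : sl A' l')).
  by rewrite !sl_extend_val f_lie.
Qed.

End Restriction.

Lemma sl_extend_inverse (K : fieldType) (A' A : algType K) (l' l : nat)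
    (f : {linear sl A' l' -> sl A l}) (g : sl A l -> sl A' l') :
  {morph f : x y / lie x y} -> cancel f g -> cancel g f ->
  sl_inverse (sl_extend f) (sl_extend g).
Proof.
move=> f_lie fK gK; split.
- by apply: sl_extend_morphism => // c x y; rewrite linearP.
- apply: sl_extend_morphism => [c x y|x y]; apply: (can_inj fK).
    by rewrite linearP !gK.
  by rewrite f_lie !gK.
- move=> x Sx; rewrite -[x]/(val (DerivedAlgebra Sx : sl A' l')).
  by rewrite !sl_extend_val fK.
- move=> x Sx; rewrite -[x]/(val (DerivedAlgebra Sx : sl A l)).
  by rewrite !sl_extend_val gK.
Qed.

Section InducedIsomorphism.
Variables (K : fieldType) (Q' Q : algType K) (l : nat).

Definition cartan_diag (B : algType K) (s : 'I_l -> K) : gl B l :=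
  \sum_(i < l) s i *: (delta_mx i i : gl B l).

(** The scalar [e] is 1 for entrywise maps and -1 for minus the transpose; in both cases the
    standard Cartan subalgebras correspond. *)
Definition gl_isomorphism (T : gl Q' l -> gl Q l) (e : K) : Prop :=
  [/\ forall c x y, T (c *: x + y) = c *: T x + T y,
      forall x y, T (lie x y) = lie (T x) (T y), bijective T, e != 0
    & forall s, T (cartan_diag Q' s) = cartan_diag Q (fun i => e * s i)].

Lemma lie_linear_derived (A A' : algType K) (T : gl A l -> gl A' l) :
  (forall c x y, T (c *: x + y) = c *: T x + T y) ->
  (forall x y, T (lie x y) = lie (T x) (T y)) ->
  forall x, x \in in_derived (L := gl A l) -> T x \in in_derived (L := gl A' l).
Proof.
move=> T_lin T_lie x /asboolP[m [c [a [b ->]]]].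
have T0 : T 0 = 0.
  by have := T_lin (-1) 0 0; rewrite scaler0 addr0 scaleN1r addNr.
have TD u v : T (u + v) = T u + T v by have := T_lin 1 u v; rewrite !scale1r.
rewrite (big_morph T TD T0); apply: rpred_sum => i _.
rewrite -[_ *: _]addr0 T_lin T0 addr0 T_lie.
by apply: rpredZ; exact: lie_in_derived.
Qed.

Lemma gl_isomorphism_conjugates (T : gl Q' l -> gl Q l) (e : K)
    (f : {linear sl Q' l -> sl Q l}) :
  gl_isomorphism T e -> lie_isomorphism f ->
  exists sigma : {linear sl Q l -> sl Q l}, lie_automorphism sigma /\
    sigma @` (f @` standard_cartan Q' l) = standard_cartan Q l.
Proof.
move=> [T_lin T_lie [U TK UK] e0 T_diag] [f_lie [g fK gK]].
have U_lin c x y : U (c *: x + y) = c *: U x + U y.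
  by apply: (can_inj TK); rewrite T_lin !UK.
have U_lie x y : U (lie x y) = lie (U x) (U y).
  by apply: (can_inj TK); rewrite T_lie !UK.
pose t (x : sl Q' l) : sl Q l := DerivedAlgebra (lie_linear_derived T_lin T_lie (valP x)).
pose u (x : sl Q l) : sl Q' l := DerivedAlgebra (lie_linear_derived U_lin U_lie (valP x)).
have tK : cancel t u by move=> x; apply: val_inj; exact: TK.
have uK : cancel u t by move=> x; apply: val_inj; exact: UK.
have s_lin : linear (t \o g).
  move=> c x y /=; have -> : g (c *: x + y) = c *: g x + g y.
    by apply: (can_inj fK); rewrite linearP !gK.
  by apply: val_inj; exact: T_lin.
pose sigma : {linear sl Q l -> sl Q l} :=
  HB.pack (t \o g) (GRing.isLinear.Build K (sl Q l) (sl Q l) *:%R (t \o g) s_lin).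
exists sigma; split.
  split=> [x y /=|].
    have -> : g (lie x y) = lie (g x) (g y).
      by apply: (can_inj fK); rewrite f_lie !gK.
    by apply: val_inj; exact: T_lie.
  exists (f \o u) => x /=; first by rewrite tK gK.
  by rewrite fK uK.
apply/seteqP; split=> [z [y [x [s [s0 xs]] <-] <-]|z [s [s0 zs]]] /=.
  exists (fun i => e * s i); split; first by rewrite -mulr_sumr s0 mulr0.
  by rewrite fK -[RHS]/(cartan_diag Q (fun i => e * s i)) -T_diag; exact: (congr1 T xs).
exists (f (u z)); last by rewrite fK uK.
exists (u z) => //; exists (fun i => e^-1 * s i); split; first by rewrite -mulr_sumr s0 mulr0.
apply: (can_inj TK); rewrite /= UK -[RHS]/(T (cartan_diag Q' _)) T_diag zs.
by apply: eq_bigr => i _; rewrite mulVKf.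
Qed.

Lemma map_gl_isomorphism (theta : {lrmorphism Q' -> Q}) : bijective theta ->
  exists T, gl_isomorphism T 1.
Proof.
move=> [h hK Kh]; exists (fun x => map_mx theta x); split=> //.
- by move=> c x y; apply/matrixP=> i j; rewrite !mxE linearP.
- by move=> x y; rewrite -[RHS]/(map_mx theta _ *m map_mx theta _ - _ *m _) -!map_mxM -map_mxB.
- by exists (fun x => map_mx h x) => x; apply/matrixP=> i j; rewrite !mxE ?hK ?Kh.
- exact: oner_neq0.
- move=> s; apply/matrixP=> i j; rewrite mxE !summxE raddf_sum; apply: eq_bigr => k _ /=.
  by rewrite !mxE linearZ /= rmorph_nat mul1r.
Qed.

(** Read in [Q], [theta] reverses products, so the transposed entrywise map is an anti-homomorphism
    of matrix algebras and its negative preserves brackets. *)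
Lemma transpose_gl_isomorphism (theta : {lrmorphism Q' -> Q^c}) : bijective theta ->
  exists T, gl_isomorphism T (-1).
Proof.
move=> [h hK Kh].
pose th (a : Q') : Q := theta a.
have thP c a b : th (c *: a + b) = c *: th a + th b by exact: (linearP theta c a b).
have thB a b : th (a - b) = th a - th b by exact: (raddfB theta a b).
have thM a b : th (a * b) = th b * th a by exact: (rmorphM theta a b).
have th_sum (F : 'I_l -> Q') : th (\sum_k F k) = \sum_k th (F k) by exact: (raddf_sum theta).
have thZ c a : th (c *: a) = c *: th a by exact: (linearZ_LR theta c a).
have th_nat m : th m%:R = m%:R by exact: (rmorph_nat theta m).
pose T (x : gl Q' l) : gl Q l := \matrix_(i, j) - th (x j i).
exists T; split.
- by move=> c x y; apply/matrixP=> i j; rewrite !mxE thP opprD scalerN.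
- move=> x y; apply/matrixP=> i j; rewrite !gl_lieE !mxE thB !th_sum opprB.
  by congr (_ - _); apply: eq_bigr => k _; rewrite !mxE thM mulrNN.
- pose U (x : gl Q l) : gl Q' l := \matrix_(i, j) (h : Q -> Q') (- x j i).
  exists U => x; apply/matrixP=> i j.
    by rewrite [LHS]mxE [T x _ _]mxE opprK; exact: hK.
  by rewrite [LHS]mxE [U x _ _]mxE /th Kh opprK.
- by rewrite oppr_eq0 oner_neq0.
- move=> s; apply/matrixP=> i j; rewrite mxE !summxE th_sum -sumrN; apply: eq_bigr => k _ /=.
  by rewrite !mxE thZ th_nat mulN1r scaleNr andbC.
Qed.

End InducedIsomorphism.

Lemma sl_torus_conjugacy (K : fieldType) (l l' : nat) (Q Q' : algType K)
    (f : {linear sl Q' l' -> sl Q l}) : [pchar K] =i pred0 -> (2 <= l)%N -> (2 <= l')%N ->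
  quantum_torus Q -> quantum_torus Q' -> lie_isomorphism f ->
  l = l' /\ exists sigma : {linear sl Q l -> sl Q l},
    lie_automorphism sigma /\ sigma @` (f @` standard_cartan Q' l') = standard_cartan Q l.
Proof.
move=> K0 hl hl' [n [q [x [y [qP presQ]]]]] [n' [q' [x' [y' [qP' presQ']]]]] f_iso.
case: l hl f f_iso => [//|r] r0 f f_iso; case: l' hl' f f_iso => [//|r'] r'0 f f_iso.
have XB := presentation_basis K0 qP presQ.
have XB' := presentation_basis K0 qP' presQ'.
have [f_lie [g fK gK]] := f_iso.
have FG := sl_extend_inverse f_lie fK gK.
have rr : r = r'.
  have le := sl_rank_le K0 FG r'0 XB.
  have ge := sl_rank_le K0 (sl_inverse_sym FG) r0 XB'.
  by apply/eqP; rewrite eqn_leq -(ltnS r r') ge -(ltnS r' r) le.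
split; first by rewrite rr.
subst r'; have [phi [phi_bij phiD [phiB|phiB]]] :=
  exponent_bijection K0 FG r0 XB (presentation_basis K0 qP' presQ').
  have [theta theta_bij] := torus_isomorphism phi_bij phiD phiB.
  by have [T /gl_isomorphism_conjugates] := map_gl_isomorphism r.+1 theta_bij; apply.
(* When the bicharacters are inverse to each other, passing to the opposite algebra of [Q] restores
   equality. *)
have phiB' a b : commutation (converse_torus_basis XB) (phi a) (phi b) =
    commutation (presentation_basis K0 qP' presQ') a b.
  by rewrite converse_commutation phiB invrK.
have [theta theta_bij] := torus_isomorphism phi_bij phiD phiB'.
by have [T /gl_isomorphism_conjugates] := transpose_gl_isomorphism r.+1 theta_bij; apply.
Qed.

Theorem mainTheorem1 (R : realType) (l l' : nat) (Q Q' : algType R[i])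
    (hl : (2 <= l)%N) (hl' : (2 <= l')%N)
    (torusQ : quantum_torus Q) (torusQ' : quantum_torus Q')
    (non_fgc : ~ fgc (sl Q l)) (non_fgc' : ~ fgc (sl Q' l'))
    (f : {linear sl Q' l' -> sl Q l}) (f_iso : lie_isomorphism f) :
  l = l' /\
  exists sigma : {linear sl Q l -> sl Q l},
    lie_automorphism sigma /\
    sigma @` (f @` standard_cartan Q' l') = standard_cartan Q l.
Proof.
apply: sl_torus_conjugacy => //; exact: pchar_num.
Qed.
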